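(* Let $G=(V,E)$ be a finite simple connected undirected graph on $n$ vertices with cut parameters $\alpha\leq\beta$, and consider the generalized random shortest path metric on $G$. For any rule $R$, let $\mathsf{IN}_R$ be the length of the tour computed by the insertion heuristic with rule $R$, and let $\mathsf{TSP}$ be the length of a shortest TSP tour. Then $\mathbb{E}[\mathsf{IN}_R]=O(1/\alpha)$ and $\mathbb{E}\left[\frac{\mathsf{IN}_R}{\mathsf{TSP}}\right]=O(\beta/\alpha)$.
   Context: Generalized random shortest path metric on $G$: each edge $e\in E$ independently receives a weight $w(e)\sim\mathrm{Exp}(1)$, and $d(u,v)$ is the minimum total weight of a $u$–$v$ path in $G$; the TSP instance is the complete graph on $V$ with distances $d$. Cut parameters: for $\varnothing\neq U\subsetneq V$ let $\delta(U)$ be the set of edges with exactly one endpoint in $U$ and $\mu_U=|U|(n-|U|)$; $\alpha=\min_U|\delta(U)|/\mu_U$, $\beta=\max_U|\delta(U)|/\mu_U$. Insertion heuristic with rule $R$: start with an optimal tour on a few initial vertices chosen according to a predefined rule $R$; then repeatedly choose a vertex according to $R$ and insert it into the current tour at the position that increases the tour length the least. The $O$-constants are absolute and independent of $R$. *)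

(* Defs.v *)
From HB Require Import structures.
From mathcomp Require Export all_boot all_order all_algebra.
From mathcomp Require Export all_classical all_reals all_analysis.
Export Order.TTheory GRing.Theory Num.Theory.

Set Implicit Arguments.
Unset Strict Implicit.
Unset Printing Implicit Defensive.

Local Open Scope ring_scope.

Section Graph.
Context {R : realType} {V : finType}.
Implicit Types (e : rel V) (U : {set V}).

(* A finite simple graph on V is a symmetric irreflexive relation e; an
   undirected edge is the two-element set of its endpoints. *)
Definition edges e : {set {set V}} :=
  [set [set p.1; p.2]%SET | p in [pred p : V * V | e p.1 p.2]]%SET.

Definition cut e U : {set {set V}} :=
  [set a in edges e | #|a :&: U| == 1%N]%SET.

Definition mu_cut U : nat := (#|U| * (#|V| - #|U|))%N.

Definition cut_ratio e U : R := #|cut e U|%:R / (mu_cut U)%:R.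

(* 0 < #|U| < #|V| says that U is nonempty and proper. For 1 < #|V| there is
   such a U, so that the infimum and supremum below, over a finite nonempty
   set of reals, are a minimum and a maximum. *)
Definition cut_ratios e : set R :=
  [set cut_ratio e U | U in [set U : {set V} | (0 < #|U| < #|V|)%N]]%classic.

Definition alpha e : R := inf (cut_ratios e).
Definition beta e : R := sup (cut_ratios e).

(* Weight of the walk that starts in x and then visits the vertices in p.
   Only the values of w at edges of the graph matter in what follows. *)
Definition path_weight (w : {set V} -> R) (x : V) (p : seq V) : R :=
  \sum_(q <- zip (x :: p) p) w [set q.1; q.2]%SET.

(* The infimum is over the finite set of simple u-v paths, nonempty if the
   graph is connected, hence it is a minimum. *)
Definition sp_dist e (w : {set V} -> R) (u v : V) : R :=
  inf [set path_weight w u p | p in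
        [set p : seq V | [&& path e u p, uniq (u :: p) & last u p == v]]]%classic.

End Graph.

Section TSP.
Context {R : realType} {V : finType}.
Implicit Types (d : V -> V -> R) (A : {set V}) (t : seq V).

(* A tour is a duplicate-free sequence of vertices, read cyclically. *)
Definition is_tour A t : Prop := uniq t /\ t =i A.

Definition tour_length d t : R := \sum_(x <- t) d x (next t x).

Definition optimal_tour d A t : Prop :=
  is_tour A t /\ forall t', is_tour A t' -> tour_length d t <= tour_length d t'.

Definition tsp d : R :=
  inf [set tour_length d t | t in [set t | is_tour [set: V]%SET t]]%classic.

Definition insert_at (i : nat) (v : V) t : seq V := take i t ++ v :: drop i t.

Definition insertion_cost d t v i : R :=
  tour_length d (insert_at i v t) - tour_length d t.

Definition cheapest_position d t v i : Prop :=
  (i <= size t)%N /\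
  forall j, (j <= size t)%N -> insertion_cost d t v i <= insertion_cost d t v j.

End TSP.

(* A rule sees the instance d: rule_init chooses the initial vertices, and
   rule_next chooses the vertex to insert into the current tour t. *)
Record insertion_rule (R : realType) (V : finType) := InsertionRule {
  rule_init : (V -> V -> R) -> {set V};
  rule_next : (V -> V -> R) -> seq V -> V;
  rule_init_neq0 : forall d, rule_init d != finset.set0;
  rule_next_notin : forall d t,
    uniq t -> (size t < #|V|)%N -> rule_next d t \notin t }.

(* The partial tours of the heuristic. Being a relation, it leaves open how
   ties between optimal initial tours and between cheapest positions are
   broken. *)
Inductive insertion_run (R : realType) (V : finType)
    (rho : insertion_rule R V) (d : V -> V -> R) : seq V -> Prop :=
| run_init t : optimal_tour d (rule_init rho d) t -> insertion_run rho d t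
| run_insert t i :
    insertion_run rho d t -> (size t < #|V|)%N ->
    cheapest_position d t (rule_next rho d t) i ->
    insertion_run rho d (insert_at i (rule_next rho d t) t).

Definition insertion_output (R : realType) (V : finType)
    (rho : insertion_rule R V) (d : V -> V -> R) (t : seq V) : Prop :=
  insertion_run rho d t /\ is_tour [set: V]%SET t.

Section Probability.
Context {disp : measure_display} {Omega : measurableType disp} {R : realType}.
Variable P : probability Omega R.

(* Mutual independence of the finite family (X a), a in D. *)
Definition mutually_independent (I : finType) (D : {set I})
    (X : I -> {RV P >-> R}) : Prop :=
  forall (J : {set I}) (B : I -> set R), J \subset D ->
    (forall a, measurable (B a)) ->
    P [set omega | forall a, a \in J -> B a (X a omega)]%classic =
    (\prod_(a in J) P (X a @^-1` B a)%classic)%E.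

Definition iid_exponential (I : finType) (D : {set I})
    (X : I -> {RV P >-> R}) : Prop :=
  mutually_independent D X /\
  forall a, a \in D -> forall B : set R, measurable B ->
    distribution P (X a) B = exponential_prob 1 B.

End Probability.

(* Main.v *)
Require Import Defs.
From mathcomp Require Import all_boot all_order all_algebra.
From mathcomp Require Import all_classical all_reals all_analysis.
From mathcomp Require Import measurable_realfun.
From mathcomp Require Import ring lra zify.
Import Order.TTheory GRing.Theory Num.Theory.

Set Implicit Arguments.
Unset Strict Implicit.
Unset Printing Implicit Defensive.

Local Open Scope ring_scope.

(* Insertion next to the nearest vertex of the tour costs at most twice its
   distance [c v], so the final tour costs at most [2 * \sum_v c v].  The vertices
   with [2 * r < c v] are more than [2 * r] apart, hence either their [r]-balls are
   small or, the balls being disjoint, there are few of them.  With the radii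
   [x_j = 4 j^2 / (alpha n)], a ball of radius [x_j] has fewer than
   [min (2^j) (n/2 + 1)] vertices with probability at most [2^-j]: a ball with
   vertex set [U] grows at the rate [#|cut U| >= alpha #|U| (n - #|U|)], because
   exponential weights are memoryless.  Summing over the layers [x_j, x_(j+1)]
   gives [E IN <= 192 / alpha].  Memorylessness is obtained by rounding the weights
   to multiples of a mesh, which reduces it to a statement on finite products.

   A tour of length below [c / beta] contains n/4 edges of weight below
   [2 c / (beta n)]; as there are at most [beta n^2] edges, a union bound gives
   this probability at most [1 / n] for [c = 1 / 512].  On this event the trivial
   bound [IN <= 2 n TSP] is used, on the complement [IN / TSP <= IN * beta / c]. *)

(** * Walks and their weights *)

Section Walks.
Context {M : nmodType} {V : eqType}.
Implicit Types (f : V -> V -> M) (x y : V) (p : seq V).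

Definition walk_len f x p : M := \sum_(q <- zip (x :: p) p) f q.1 q.2.

Lemma walk_len_nil f x : walk_len f x [::] = 0.
Proof. by rewrite /walk_len big_nil. Qed.

Lemma walk_len_cons f x y p : walk_len f x (y :: p) = f x y + walk_len f y p.
Proof. by rewrite /walk_len /= big_cons. Qed.

Lemma walk_len_cat f x p1 p2 :
  walk_len f x (p1 ++ p2) = walk_len f x p1 + walk_len f (last x p1) p2.
Proof.
elim: p1 x => [|y p1 IH] x /=; first by rewrite walk_len_nil add0r.
by rewrite !walk_len_cons IH addrA.
Qed.

Lemma walk_len_rcons f x p y :
  walk_len f x (rcons p y) = walk_len f x p + f (last x p) y.
Proof. by rewrite -cats1 walk_len_cat walk_len_cons walk_len_nil addr0. Qed.

Lemma walk_reverse (e : rel V) f x p : symmetric e ->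
    (forall x y, f x y = f y x) -> path e x p ->
  exists p', [/\ path e (last x p) p', last (last x p) p' = x
    & walk_len f (last x p) p' = walk_len f x p].
Proof.
move=> esym fsym; elim: p x => [|y p IH] x /=.
  by move=> _; exists [::].
case/andP => exy /IH [p' [pp' lp' wp']].
exists (rcons p' x); split.
- by rewrite rcons_path pp' lp' esym.
- by rewrite last_rcons.
- by rewrite walk_len_rcons walk_len_cons lp' wp' addrC fsym.
Qed.

End Walks.

Lemma path_weightE (R : realType) (V : finType) (w : {set V} -> R) x p :
  path_weight w x p = walk_len (fun x y => w [set x; y]%SET) x p.
Proof. by []. Qed.

Section NonnegativeWalks.
Context {R : realType} {V : eqType} (e : rel V) (f : V -> V -> R).
Hypothesis f_ge0 : forall x y, e x y -> 0 <= f x y.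

Lemma walk_len_ge0 x p : path e x p -> 0 <= walk_len f x p.
Proof.
elim: p x => [|y p IH] x /=; first by rewrite walk_len_nil.
by case/andP => exy pp; rewrite walk_len_cons addr_ge0 ?f_ge0 ?IH.
Qed.

(** If the start [x] recurs in the simplified tail, only what follows that occurrence is kept; the
    dropped detour has nonnegative weight. Hence [sp_dist], an infimum over simple paths, is also a
    lower bound for the weights of arbitrary walks. *)
Lemma simple_path_le x p : path e x p ->
  exists p', [/\ path e x p', uniq (x :: p'), last x p' = last x p
    & walk_len f x p' <= walk_len f x p].
Proof.
elim: p x => [|y p IH] x /=; first by exists [::]; rewrite walk_len_nil.
case/andP => exy /IH [p' [pp' up' lp' wp']].
have [xin|xnin] := boolP (x \in y :: p'); last first.
  exists (y :: p'); split => //=.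
  - by rewrite exy.
  - by rewrite xnin.
  - by rewrite !walk_len_cons lerD2l.
have [p1 [p2 [E L]]] : exists p1 p2, p' = p1 ++ p2 /\ last y p1 = x.
  move: xin; rewrite inE => /orP[/eqP ->|xin]; first by exists [::], p'.
  case/path.splitP: xin => p1 p2.
  by exists (rcons p1 x), p2; rewrite last_rcons.
move: pp' lp' wp' up'; rewrite E cat_path last_cat walk_len_cat L.
case/andP => pp1 pp2 lp2 wp2; rewrite -cat_cons cat_uniq => /and3P[_ nh u2].
exists p2; split => //.
- rewrite /= u2 andbT; apply: contra nh => xp2.
  by apply/hasP; exists x => //; rewrite -L mem_last.
- rewrite walk_len_cons.
  have := walk_len_ge0 pp1; have := f_ge0 exy; lra.
Qed.

End NonnegativeWalks.

(** * The shortest path metric of nonnegative weights *)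

Section ShortestPathMetric.
Context {R : realType} {V : finType} (e : rel V) (w : {set V} -> R).
Hypotheses (e_sym : symmetric e) (e_conn : forall u v, connect e u v).
Hypothesis w_ge0 : forall a, a \in edges e -> 0 <= w a.

Lemma edge_mem x y : e x y -> [set x; y]%SET \in edges e.
Proof. by move=> exy; apply/imsetP; exists (x, y). Qed.

Let f x y := w [set x; y]%SET.

Let f_ge0 x y : e x y -> 0 <= f x y.
Proof. by move=> /edge_mem/w_ge0. Qed.

Let S u v := [set path_weight w u p | p in
  [set p : seq V | [&& path e u p, uniq (u :: p) & last u p == v]]]%classic.

Let S_ge0 u v : lbound (S u v) 0.
Proof. by move=> _ [p /= /and3P[pp _ _] <-]; apply: (walk_len_ge0 f_ge0). Qed.

Let S_nonempty u v : (S u v !=set0)%classic.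
Proof.
have /connectP [p pp lp] := e_conn u v.
have [p' [pp' up' lp' _]] := simple_path_le f_ge0 pp.
by exists (path_weight w u p'), p' => //=; rewrite pp' lp' -lp eqxx; move: up' => /= ->.
Qed.

Lemma sp_dist_ge0 u v : 0 <= sp_dist e w u v.
Proof. by apply: lb_le_inf; [exact: S_nonempty|exact: S_ge0]. Qed.

Lemma sp_dist_le u p : path e u p ->
  sp_dist e w u (last u p) <= path_weight w u p.
Proof.
move=> pp; have [p' [pp' up' lp' wp']] := simple_path_le f_ge0 pp.
apply: le_trans wp'; apply: ge_inf; first by exists 0; exact: S_ge0.
by exists p' => //=; rewrite pp' lp' eqxx; move: up' => /= ->.
Qed.

Lemma sp_distxx u : sp_dist e w u u = 0.
Proof.
apply/eqP; rewrite eq_le sp_dist_ge0 andbT.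
by apply: le_trans (@sp_dist_le u [::] _) _ => //; rewrite path_weightE walk_len_nil.
Qed.

Lemma sp_dist_lt_path u v r : sp_dist e w u v < r ->
  exists p, [/\ path e u p, last u p = v & path_weight w u p < r].
Proof.
move=> /(inf_lt (S_nonempty u v)).
case=> _ [p /= /and3P[pp _ /eqP lp] <-] lt_r.
by exists p.
Qed.

Lemma sp_dist_sym u v : sp_dist e w u v = sp_dist e w v u.
Proof.
suff H x y : sp_dist e w x y <= sp_dist e w y x by apply/eqP; rewrite eq_le !H.
apply: lb_le_inf; first exact: S_nonempty.
move=> _ [p /= /and3P[pp _ /eqP lp] <-].
have fsym x' y' : f x' y' = f y' x' by rewrite /f finset.setUC.
have [p' [pp' lp' wp']] := walk_reverse e_sym fsym pp.
by move: pp' lp' wp'; rewrite lp => /sp_dist_le H <-; rewrite path_weightE -/f => <-.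
Qed.

Lemma sp_dist_triangle u v x :
  sp_dist e w u x <= sp_dist e w u v + sp_dist e w v x.
Proof.
rewrite -lerBlDr; apply: lb_le_inf; first exact: S_nonempty.
move=> _ [p /= /and3P[pp _ /eqP lp] <-].
rewrite lerBlDr -lerBlDl; apply: lb_le_inf; first exact: S_nonempty.
move=> _ [q /= /and3P[pq _ /eqP lq] <-].
rewrite lerBlDl -lq -lp.
have := @sp_dist_le u (p ++ q); rewrite cat_path pp lp pq => /(_ isT).
by rewrite last_cat lp !path_weightE walk_len_cat lp.
Qed.

(* The first edge of a short path out of u is itself light. *)
Lemma sp_dist_lt_edge u v r : u != v -> sp_dist e w u v < r ->
  exists2 a, a \in edges e & u \in a /\ w a < r.
Proof.
move=> uv /sp_dist_lt_path [[|y p] [/= pp lp]]; first by rewrite lp eqxx in uv.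
case/andP: pp => exy pp; rewrite path_weightE walk_len_cons => lt_r.
exists [set u; y]%SET; first exact: edge_mem.
split; first by rewrite finset.set21.
by apply: le_lt_trans lt_r; rewrite lerDl (walk_len_ge0 f_ge0).
Qed.

End ShortestPathMetric.

(** * Tours, insertion costs and the greedy bound *)

Section Tours.
Context {R : realType} {V : finType} (d : V -> V -> R).
Implicit Types (t s : seq V) (u v x : V) (A : {set V}).

Lemma tour_length_cons x s : uniq (x :: s) ->
  tour_length d (x :: s) = walk_len d x (rcons s x).
Proof.
move=> us.
(* The vertex of return is generalised to [x0], since the recursion of [next_at] moves the head [x]
   but keeps that vertex. *)
suff H x0 : \sum_(z <- x :: s) d z (next_at z x0 x s) = walk_len d x (rcons s x0).
  by rewrite -H.
elim: s x us => [|y s IH] x us.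
  by rewrite big_seq1 /= eqxx walk_len_cons walk_len_nil addr0.
rewrite big_cons [next_at _ _ _ _]/= eqxx rcons_cons walk_len_cons -IH; last first.
  by case/andP: us.
congr (_ + _); apply: eq_big_seq => z zs /=.
case: eqP => // zx; move: us; rewrite zx cons_uniq => /andP[].
by rewrite -zx zs.
Qed.

Lemma tour_length_rot i t : uniq t -> tour_length d (rot i t) = tour_length d t.
Proof.
move=> ut; rewrite /tour_length (perm_big t) ?perm_rot //.
by apply: eq_bigr => x _; rewrite next_rot.
Qed.

Lemma perm_insert_at i v t : perm_eq (insert_at i v t) (v :: t).
Proof.
by rewrite /insert_at -cat1s perm_catCA cat1s perm_cons cat_take_drop.
Qed.

Hypotheses (d_ge0 : forall u v, 0 <= d u v) (d_xx : forall u, d u u = 0).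
Hypotheses (d_sym : forall u v, d u v = d v u).
Hypothesis d_triangle : forall u v x, d u x <= d u v + d v x.

Lemma dist_le_walk_len x s : d x (last x s) <= walk_len d x s.
Proof.
elim: s x => [|y s IH] x /=; first by rewrite d_xx walk_len_nil.
by rewrite walk_len_cons (le_trans (d_triangle x y _)) // lerD2l.
Qed.

Lemma dist_le_tour_length t u v :
  uniq t -> u \in t -> v \in t -> d u v <= tour_length d t.
Proof.
move=> ut uint vint; case: (rot_to uint) => i s E.
have us : uniq (u :: s) by rewrite -E rot_uniq.
rewrite -(tour_length_rot i ut) E tour_length_cons //.
(* With the closing copy of [u] included, the case [v = u] needs no separate treatment. *)
have : v \in rcons s u by rewrite mem_rcons -E mem_rot.
case/path.splitP => p1 p2.
rewrite walk_len_cat.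
have := dist_le_walk_len u (rcons p1 v); rewrite last_rcons => /le_trans; apply.
by rewrite lerDl sumr_ge0.
Qed.

(** Placing [v] right after [u] replaces a distance [d u x] by [d u v + d v x], and
    [d v x <= d v u + d u x]. *)
Lemma insertion_next_to t u v : uniq t -> v \notin t -> u \in t ->
  exists2 i, (i <= size t)%N &
    tour_length d (insert_at i v t) <= tour_length d t + 2 * d v u.
Proof.
move=> ut vt ut'; case/splitPr: ut' ut vt => t1 t2 ut vt.
exists (size t1).+1; first by rewrite size_cat /= addnS ltnS leq_addr.
have E : insert_at (size t1).+1 v (t1 ++ u :: t2) = t1 ++ u :: v :: t2.
  rewrite -cat_rcons /insert_at -(size_rcons t1 u) take_size_cat // drop_size_cat //.
  by rewrite cat_rcons.
have uE : uniq (t1 ++ u :: v :: t2).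
  by rewrite -E (perm_uniq (perm_insert_at _ _ _)) /= vt.
rewrite E -(tour_length_rot (size t1) uE) -(tour_length_rot (size t1) ut).
move: uE ut; rewrite -(rot_uniq (size t1)) -(rot_uniq (size t1) (_ ++ _)).
rewrite !rot_size_cat /= => uE ut.
rewrite !tour_length_cons //= walk_len_cons.
(* The head of this list is the old successor of [u], which is [u] itself if the tour is a
   singleton. The list is never empty, but the inequality holds in that case too. *)
case: (rcons (t2 ++ t1) u) => [|x s].
  by rewrite !walk_len_nil; have := d_ge0 v u; have := d_sym u v; lra.
rewrite !walk_len_cons; have := d_triangle v u x; have := d_sym u v; lra.
Qed.

(* [c v] plays the role of the distance from [v] to the nearest vertex that was
   inserted before it, and [z] that of the first vertex. *)
Definition greedy_bound A (L : R) : Prop :=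
  exists (c : V -> R) (z : V),
  [/\ z \in A, forall v, 0 <= c v, forall v, v \in A -> c v <= d v z,
      forall u v, u \in A -> v \in A -> u != v -> Num.min (c u) (c v) <= d u v
    & L <= 2 * \sum_(v in A) c v].

Lemma greedy_bound1 x : greedy_bound [set x]%SET 0.
Proof.
exists (fun=> 0), x; split => //.
- by rewrite inE.
- by move=> u v _ _ _; rewrite minxx.
- by rewrite big1 // mulr0.
Qed.

(** The new value [c v] is the distance from [v] to its nearest vertex [u] in [A]. Minimality gives
    both [c v <= d v z] and the separation from all of [A]; the hypothesis at this [u] bounds the
    increment by [2 * c v]. *)
Lemma greedy_bound_insert A (L L' : R) v : greedy_bound A L -> v \notin A ->
  (forall u, u \in A -> L' <= L + 2 * d v u) -> greedy_bound (v |: A)%SET L'.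
Proof.
case=> c [z [zA c0 cz cc LE]] vA H.
case: (@arg_minP _ R V z (mem A) (d v) zA) => u uA umin.
have cv x : x \in A -> (if x == v then d v u else c x) = c x.
  by move=> xA; case: eqP => // E; move: vA; rewrite -E xA.
exists (fun x => if x == v then d v u else c x), z; split.
- by rewrite !inE zA orbT.
- by move=> x; case: ifP.
- move=> x; rewrite !inE => /orP[/eqP ->|xA]; first by rewrite eqxx umin.
  by rewrite cv // cz.
- move=> x y; rewrite !inE => /orP[/eqP ->|xA] /orP[/eqP ->|yA]; rewrite ?eqxx //.
  + by move=> _; rewrite ge_min umin.
  + by move=> _; rewrite ge_min (d_sym x) umin ?orbT.
  + by move=> xy; rewrite !cv // cc.
- rewrite big_setU1 //= eqxx (eq_bigr _ cv).
  by have := H _ uA; lra.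
Qed.

Lemma greedy_bound_cheapest_insertion t i v : uniq t -> v \notin t ->
  cheapest_position d t v i ->
  greedy_bound [set x in t]%SET (tour_length d t) ->
  greedy_bound [set x in insert_at i v t]%SET (tour_length d (insert_at i v t)).
Proof.
move=> ut vt [_ cheap] gb.
have -> : [set x in insert_at i v t]%SET = (v |: [set x in t])%SET.
  by apply/finset.setP => x; rewrite !inE (perm_mem (perm_insert_at _ _ _)) inE.
apply: (greedy_bound_insert gb); first by rewrite inE.
move=> u; rewrite inE => uint.
have [j jt] := insertion_next_to ut vt uint.
by move: (cheap j jt); rewrite /insertion_cost; lra.
Qed.

(** Cheapest insertion along an enumeration of [A] builds such a tour. An optimal tour on the
    initial set of a rule is no longer, hence it satisfies the bound as well, however large that set
    is. *)
Lemma greedy_bound_tour A : A != finset.set0 ->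
  exists2 t, is_tour A t & greedy_bound A (tour_length d t).
Proof.
have [s ->] : exists s, A = [set x in s]%SET.
  by exists (enum A); apply/finset.setP => x; rewrite inE mem_enum.
elim: s {A} => [|v s IH].
  by case/negP; apply/eqP/finset.setP => x; rewrite !inE.
have -> : [set x in v :: s]%SET = (v |: [set x in s])%SET.
  by apply/finset.setP => x; rewrite !inE.
move=> _; have [s0|/IH [t [ut tE] gb]] := eqVneq [set x in s]%SET finset.set0.
  exists [:: v]; last first.
    rewrite s0 finset.setU0 tour_length_cons // walk_len_cons walk_len_nil d_xx addr0.
    exact: greedy_bound1.
  by split => // x; rewrite s0 finset.setU0 !inE.
have [vs|vs] := boolP (v \in [set x in s]%SET).
  have -> : (v |: [set x in s])%SET = [set x in s]%SET.
    by apply/finset.setUidPr; rewrite finset.sub1set.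
  by exists t.
have vt : v \notin t by rewrite tE.
case: (@arg_minP _ R 'I_(size t).+1 ord0 xpredT
  (fun i => insertion_cost d t v i) isT) => i _ imin.
exists (insert_at i v t).
  split; first by rewrite (perm_uniq (perm_insert_at _ _ _)) /= vt.
  by move=> x; rewrite (perm_mem (perm_insert_at _ _ _)) !inE tE inE.
have tE' : [set x in t]%SET = [set x in s]%SET.
  by apply/finset.setP => x; rewrite !inE tE inE.
have -> : (v |: [set x in s])%SET = [set x in insert_at i v t]%SET.
  apply/finset.setP => x; rewrite [RHS]inE (perm_mem (perm_insert_at _ _ _)) !inE tE inE.
  by [].
apply: greedy_bound_cheapest_insertion => //; last by rewrite tE'.
split; first by rewrite -ltnS.
by move=> j; rewrite -ltnS => jt; exact: (imin (Ordinal jt)).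
Qed.

Lemma greedy_bound_le A (L L' : R) : L' <= L -> greedy_bound A L -> greedy_bound A L'.
Proof.
move=> le [c [z [? ? ? ? ?]]]; exists c, z; split => //; exact: le_trans le _.
Qed.

Lemma insertion_run_greedy (rho : insertion_rule R V) t :
  insertion_run rho d t ->
  uniq t /\ greedy_bound [set x in t]%SET (tour_length d t).
Proof.
elim=> {t} [t [[ut tE] topt]|t i _ [ut gb] st cheap].
  split => //.
  have -> : [set x in t]%SET = rule_init rho d.
    by apply/finset.setP => x; rewrite inE tE.
  have [t' tt' gb] := greedy_bound_tour (rule_init_neq0 rho d).
  exact: greedy_bound_le (topt _ tt') gb.
have nt := rule_next_notin rho d ut st; split.
  by rewrite (perm_uniq (perm_insert_at _ _ _)) /= nt.
exact: greedy_bound_cheapest_insertion.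
Qed.

Lemma insertion_output_greedy (rho : insertion_rule R V) t :
  insertion_output rho d t -> greedy_bound [set: V]%SET (tour_length d t).
Proof.
case=> /insertion_run_greedy [_ gb] [_ tE].
suff <- : [set x in t]%SET = [set: V]%SET by [].
by apply/finset.setP => x; rewrite inE tE.
Qed.

(** Each [c v] is at most [d v z], which is at most the length of any tour through [v] and [z]. *)
Lemma greedy_bound_le_tour (L : R) t : is_tour [set: V]%SET t ->
  greedy_bound [set: V]%SET L -> L <= 2 * #|V|%:R * tour_length d t.
Proof.
move=> [ut tE] [c [z [_ _ cz _ /le_trans]]]; apply.
rewrite -mulrA ler_wpM2l //.
apply: (@le_trans _ _ (\sum_(v in [set: V]%SET) tour_length d t)).
  apply: ler_sum => v _; apply: (le_trans (cz v _)); first by rewrite inE.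
  by apply: dist_le_tour_length; rewrite ?tE ?inE.
by rewrite sumr_const cardsT mulr_natl.
Qed.

Lemma insertion_output_le_tsp (rho : insertion_rule R V) t :
  insertion_output rho d t -> (0 < #|V|)%N ->
  tour_length d t <= 2 * #|V|%:R * tsp d.
Proof.
move=> out V0; have c0 : 0 < 2 * #|V|%:R :> R by rewrite mulr_gt0 // ltr0n.
rewrite mulrC -ler_pdivrMr //; apply: lb_le_inf.
  by exists (tour_length d t), t => //; case: out.
move=> _ [t' /= tt' <-]; rewrite ler_pdivrMr // mulrC.
apply: greedy_bound_le_tour => //; exact: insertion_output_greedy out.
Qed.

Lemma tour_length_ge0 t : 0 <= tour_length d t.
Proof. by apply: sumr_ge0. Qed.

End Tours.

(** * Packing of disjoint balls *)

Lemma sum_card_disjoint (V : finType) (A : {set V}) (S : V -> {set V}) :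
  (forall u v x, u \in A -> v \in A -> x \in S u -> x \in S v -> u = v) ->
  (\sum_(v in A) #|S v| <= #|V|)%N.
Proof.
move=> disj.
(* Double counting: after the exchange of the sums, each [x] is counted for at most one [v]. *)
have E v : #|S v| = (\sum_(u : V) (u \in S v))%N by rewrite -sum1_card big_mkcond.
rewrite (eq_bigr _ (fun v _ => E v)) exchange_big /= -sum1_card.
apply: leq_sum => x _; rewrite -big_mkcondr sum1_card.
apply/card_le1_eqP => u v; rewrite !unfold_in => /andP[uA xu] /andP[vA xv].
by rewrite (disj u v x).
Qed.

Section Packing.
Context {R : realType} {V : finType} (d : V -> V -> R).
Hypothesis d_sym : forall u v, d u v = d v u.
Hypothesis d_triangle : forall u v x, d u x <= d u v + d v x.
Hypothesis d_xx : forall u, d u u = 0.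
Hypothesis V_gt0 : (0 < #|V|)%N.

(* The vertices with [2 * r < c v] together with [z] are more than [2 * r]
   apart, so that the balls of radius [r] around them are disjoint. *)
Lemma far_vertices_bound (c : V -> R) (z : V) (r : R) (j : nat) (B : {set V}) :
  (forall v, c v <= d v z) ->
  (forall u v, u != v -> Num.min (c u) (c v) <= d u v) ->
  0 <= r ->
  (forall v, v \notin B ->
     (minn (2 ^ j) (#|V|./2.+1) <= #|[set u | (d v u <= r)%R]%SET|)%N) ->
  (#|[set v | 2 * r < c v]%SET|%:R <= #|V|%:R / 2 ^+ j + #|B|%:R :> R).
Proof.
move=> cz cc r0 Bgood.
set N := [set v | _]%SET; pose K := minn (2 ^ j) (#|V|./2.+1).
set S := fun v => [set u | d v u <= r]%SET.
have close u v x : x \in S u -> x \in S v -> d u v <= 2 * r.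
  by rewrite !inE (d_sym v) => ux xv; have := d_triangle u x v; lra.
have sepN u v x : u \in N -> v \in N -> x \in S u -> x \in S v -> u = v.
  move=> uN vN xu xv; have H := close _ _ _ xu xv; move: uN vN.
  rewrite !inE => uN vN; apply/eqP; case: eqVneq => // /cc.
  by rewrite leNgt lt_min (le_lt_trans H uN) (le_lt_trans H vN).
have sepz v x : v \in N -> x \in S v -> x \in S z -> False.
  move=> vN xv xz; have H := close _ _ _ xv xz; move: vN.
  by rewrite inE; have := cz v; lra.
have Sbig v : v \in N :\: B -> (K <= #|S v|)%N by rewrite inE => /andP[/Bgood].
have sub_disj (A : {set V}) : A \subset N -> (\sum_(v in A) #|S v| <= #|V|)%N.
  move=> AN; apply: (@sum_card_disjoint _ A S) => u v x uA vA.
  by apply: sepN; exact: (fintype.subsetP AN).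
have ND : (#|N| <= #|N :\: B| + #|N :&: B|)%N by rewrite addnC cardsID.
have NB : (#|N :&: B| <= #|B|)%N by rewrite subset_leq_card // finset.subsetIr.
have NK : (#|N :\: B| * K <= #|V|)%N.
  apply: leq_trans (sub_disj _ (finset.subsetDl N B)).
  by rewrite -sum_nat_const; apply: leq_sum => v /Sbig.
have pow0 : 0 < 2 ^+ j :> R by rewrite exprn_gt0.
have [le|lt] := leqP (2 ^ j) (#|V|./2.+1).
  move: NK; rewrite /K (minn_idPl le) => NK.
  apply: (@le_trans _ _ (#|N :\: B| + #|B|)%:R).
    by rewrite ler_nat (leq_trans ND) // leq_add2l.
  by rewrite natrD lerD2r ler_pdivlMr // -natrX -natrM ler_nat.
(* Now [K] exceeds half of the vertices, so two disjoint balls of that size cannot coexist. If [z]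
   is in [B], there is at most one far vertex outside [B], and [z], which is not far, makes up for
   it. If [z] is not in [B], its own large ball leaves no room for such a vertex. *)
have {}KE : K = #|V|./2.+1 by rewrite /K (minn_idPr _) // ltnW.
suff : (#|N| <= #|B|)%N.
  move=> NleB; apply: (@le_trans _ _ #|B|%:R); first by rewrite ler_nat.
  by rewrite lerDr divr_ge0 // ler0n.
have zN : z \notin N.
  by rewrite inE -leNgt (le_trans (cz z)) // d_xx mulr_ge0.
have [zB|zB] := boolP (z \in B).
  have N1 : (#|N :\: B| <= 1)%N.
    rewrite leqNgt; apply/negP => N2; move: NK; rewrite KE.
    by have := odd_double_half #|V|; have := leq_b1 (odd #|V|); nia.
  apply: leq_trans ND _.
  have : (#|N :&: B| < #|B|)%N.
    apply: proper_card; apply/properP; split; first exact: finset.subsetIr.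
    by exists z => //; rewrite inE (negbTE zN).
  lia.
suff : #|N :\: B| = 0%N by lia.
apply/eqP; rewrite cards_eq0; apply/negP => /negP /set0Pn [v vNB].
have vN : v \in N by move: vNB; rewrite inE => /andP[].
have zv : z != v by apply: contra zN => /eqP ->.
have : (\sum_(u in [set z; v]%SET) #|S u| <= #|V|)%N.
  apply: (@sum_card_disjoint _ _ S) => a b x.
  by move=> /finset.set2P[->|->] /finset.set2P[->|->] // xa xb; case: (sepz v x).
rewrite big_setU1 ?inE //= big_set1.
have h1 : (K <= #|S v|)%N := Sbig v vNB.
have h2 : (K <= #|S z|)%N := Bgood z zB.
move: h1 h2; rewrite KE => h1 h2 h3.
have h4 := odd_double_half #|V|; have h5 := leq_b1 (odd #|V|).
have h6 := leq_trans (leq_add h2 h1) h3.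
move: h6; rewrite -[X in (_ <= X)%N]h4 -addnn.
by move: (#|V|./2) (odd #|V|) => k [] /=; lia.
Qed.

(** A layer-cake bound with breakpoints [2 * x j]: a layer is charged in full as soon as [c] exceeds
    its lower end. *)
Lemma truncated_layers (x : nat -> R) (c : R) m : x 0%N = 0 -> 0 <= c ->
  (forall j, x j <= x j.+1) ->
  Num.min c (2 * x m) <= \sum_(j < m) 2 * (x j.+1 - x j) * (2 * x j < c)%R%:R.
Proof.
move=> x0 c0 xle; elim: m => [|m IH].
  by rewrite big_ord0 x0 mulr0 ge_min lexx orbT.
rewrite big_ord_recr /= ; case: ltP => h.
  rewrite mulr1; apply: le_trans (_ : 2 * x m + 2 * (x m.+1 - x m) <= _).
    by rewrite ge_min; apply/orP; right; lra.
  by rewrite lerD2r (le_trans _ IH) // le_min lexx (ltW h).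
rewrite mulr0 addr0 (le_trans _ IH) // le_min !ge_min lexx /=.
by rewrite h.
Qed.

Lemma greedy_bound_layers (x : nat -> R) (B : nat -> {set V}) (L : R) :
  x 0%N = 0 -> (forall j, x j <= x j.+1) -> (forall y, exists m, y <= x m) ->
  (forall j v, v \notin B j ->
     (minn (2 ^ j) (#|V|./2.+1) <= #|[set u | (d v u <= x j)%R]%SET|)%N) ->
  greedy_bound d [set: V]%SET L ->
  exists m, L <= \sum_(j < m)
    4 * (x j.+1 - x j) * (#|V|%:R / 2 ^+ j + #|B j|%:R).
Proof.
move=> x0 xle xoo Bgood [c [z [_ c0 cz cc LE]]].
have x_ge0 j : 0 <= x j by elim: j => [|j IH]; rewrite ?x0 // (le_trans IH).
(* With [x m] above the sum of all [c v], the truncation at [2 * x m] affects no vertex. *)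
have [m xm] := xoo (\sum_v c v).
exists m; apply: (le_trans LE).
have cm v : c v <= 2 * x m.
  apply: le_trans (_ : x m <= _); last by have := x_ge0 m; lra.
  apply: le_trans xm; rewrite (bigD1 v) //= lerDl sumr_ge0 //.
apply: (@le_trans _ _ (2 * \sum_v \sum_(j < m) 2 * (x j.+1 - x j) * (2 * x j < c v)%R%:R)).
  rewrite ler_wpM2l // (eq_bigl xpredT); last by move=> v; rewrite inE.
  apply: ler_sum => v _; apply: le_trans (truncated_layers m x0 (c0 v) xle).
  by rewrite le_min lexx cm.
rewrite exchange_big /= mulr_sumr; apply: ler_sum => j _.
rewrite -mulr_sumr mulrA.
have -> : 2 * (2 * (x j.+1 - x j)) = 4 * (x j.+1 - x j) by ring.
rewrite ler_wpM2l //; first by have := xle j; lra.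
have -> : \sum_v (2 * x j < c v)%R%:R = #|[set v | 2 * x j < c v]%SET|%:R :> R.
  by rewrite -sum1_card natr_sum [RHS]big_mkcond /=; apply: eq_bigr => v _; rewrite inE; case: ifP.
apply: (@far_vertices_bound c z) => //.
- by move=> v; apply: cz; rewrite inE.
- by move=> u v; apply: cc; rewrite inE.
- exact: Bgood.
Qed.

End Packing.

(** * Product laws on finite configurations *)

Section ProductLaw.
Context {R : realType} {I J : finType} (p : I -> J -> R).
Hypothesis p_ge0 : forall a x, 0 <= p a x.

Definition product_law (c : {ffun I -> J}) : R := \prod_a p a (c a).

Definition pr (A : pred {ffun I -> J}) : R := \sum_(c | A c) product_law c.

Lemma product_law_ge0 c : 0 <= product_law c.
Proof. by apply: prodr_ge0 => a _; exact: p_ge0. Qed.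

Lemma pr_ge0 A : 0 <= pr A.
Proof. by apply: sumr_ge0 => c _; exact: product_law_ge0. Qed.

Lemma pr_le (A B : pred {ffun I -> J}) : (forall c, A c -> B c) -> pr A <= pr B.
Proof.
move=> AB; rewrite /pr [leLHS]big_mkcond [leRHS]big_mkcond /=.
apply: ler_sum => c _; case: ifP => [/AB ->//|_].
by case: ifP => // _; exact: product_law_ge0.
Qed.

Lemma pr_union (A B : pred {ffun I -> J}) : pr [pred c | A c || B c] <= pr A + pr B.
Proof.
rewrite /pr [leLHS]big_mkcond [X in _ <= X + _]big_mkcond [X in _ <= _ + X]big_mkcond.
rewrite -big_split /=; apply: ler_sum => c _; have := product_law_ge0 c.
by case: (A c); case: (B c) => //=; lra.
Qed.

Lemma pr_family (S : I -> pred J) :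
  pr [pred c : {ffun I -> J} | [forall a, S a (c a)]] = \prod_a \sum_(x | S a x) p a x.
Proof.
rewrite bigA_distr_big_dep; apply: eq_bigl => c /=.
by apply/forallP/familyP => H a; have := H a; rewrite ?unfold_in.
Qed.

Hypothesis p_sum1 : forall a, \sum_x p a x = 1.

Lemma pr_predT : pr predT = 1.
Proof.
rewrite /pr /product_law -(bigA_distr_bigA p) big1 // => a _; exact: p_sum1.
Qed.

Lemma pr_le1 A : pr A <= 1.
Proof. by rewrite -pr_predT; apply: pr_le. Qed.

(** Conditioning in finite form: a function of [freeze C j0 c] depends only on the coordinates
    outside [C]. *)
Definition freeze (C : {set I}) (j0 : J) (c : {ffun I -> J}) : {ffun I -> J} :=
  [ffun a => if a \in C then j0 else c a].

Definition rectangles (C : {set I}) (j0 : J) (G : pred {ffun I -> J})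
    (S : {ffun I -> J} -> I -> pred J) : pred {ffun I -> J} :=
  [pred c | G (freeze C j0 c) &&
    [forall (a | a \in C), S (freeze C j0 c) a (c a)]].

(* Conditionally on the coordinates outside [C], both events are products. *)
Lemma pr_rectangle_le (C : {set I}) (j0 : J) (G : pred {ffun I -> J})
    (S1 S2 : {ffun I -> J} -> I -> pred J) (k : R) :
  (forall c a, G c -> a \in C ->
     \sum_(x | S1 c a x) p a x <= k * \sum_(x | S2 c a x) p a x) ->
  pr (rectangles C j0 G S1) <= k ^+ #|C| * pr (rectangles C j0 G S2).
Proof.
move=> H; rewrite /pr (partition_big (freeze C j0) xpredT) //.
rewrite [X in _ * X](partition_big (freeze C j0) xpredT) // mulr_sumr.
apply: ler_sum => c0 _.
have [Gc0|nG] := boolP (G c0); last first.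
  rewrite !big_pred0 ?mulr0 // => c /=; apply/negP => /andP[/andP[+ _] /eqP E];
  by rewrite E (negbTE nG).
have [fc0|nf] := eqVneq (freeze C j0 c0) c0; last first.
  have Z c : (freeze C j0 c == c0) = false.
    apply/negP => /eqP E; case/negP: nf; rewrite -E; apply/eqP/ffunP => a.
    by rewrite !ffunE; case: (a \in C).
  by rewrite !big_pred0 ?mulr0 // => c; rewrite Z andbF.
pose F (S : {ffun I -> J} -> I -> pred J) a : pred J :=
  if a \in C then S c0 a else pred1 (c0 a).
have E S : \sum_(c | rectangles C j0 G S c && (freeze C j0 c == c0)) product_law c =
    \prod_a \sum_(x | F S a x) p a x.
  rewrite -pr_family; apply: eq_bigl => c /=.
  apply/idP/forallP => [/andP[/andP[Gc Sc] /eqP Ec] a|Fc].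
    rewrite /F; case: ifP => aC; first by move/forallP/(_ a): Sc; rewrite Ec aC.
    by rewrite /= -Ec ffunE aC.
  have Ec : freeze C j0 c = c0.
    apply/ffunP => a; have E0 : c0 a = if a \in C then j0 else c0 a.
      by rewrite -{1}fc0 ffunE.
    have := Fc a; rewrite /F ffunE; move: E0.
    by case: (a \in C) => [->|_ /eqP].
  rewrite /rectangles /= Ec Gc0 eqxx andbT /=; apply/forallP => a; apply/implyP => aC.
  by have := Fc a; rewrite /F aC.
rewrite !E (bigID (mem C)) /= [X in _ <= _ * X](bigID (mem C)) /= mulrA.
have -> : \prod_(i | i \notin C) \sum_(x | F S1 i x) p i x =
          \prod_(i | i \notin C) \sum_(x | F S2 i x) p i x.
  by apply: eq_bigr => a aC; rewrite /F (negbTE aC).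
apply: ler_wpM2r.
  by apply: prodr_ge0 => a _; apply: sumr_ge0 => x _; exact: p_ge0.
(* The factors outside [C] agree; each coordinate in [C] costs one factor [k]. *)
rewrite -prodr_const -big_split /=; apply: ler_prod => a aC.
by rewrite sumr_ge0 /=; [rewrite /F aC; exact: H | move=> x _; exact: p_ge0].
Qed.

End ProductLaw.

(** * Balls for integer edge lengths *)

Section IntegerBalls.
Context {V : finType} (e : rel V).
Hypotheses (e_sym : symmetric e) (e_irr : irreflexive e).
Implicit Types (L : {set V} -> nat) (v x y : V) (U : {set V}) (r t h : nat).

Fixpoint nat_walk_len L x (p : seq V) : nat :=
  if p is y :: p' then (L [set x; y]%SET + nat_walk_len L y p')%N else 0%N.

Lemma nat_walk_len_cat L x p q :
  nat_walk_len L x (p ++ q) = (nat_walk_len L x p + nat_walk_len L (last x p) q)%N.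
Proof. by elim: p x => //= y p IH x; rewrite IH addnA. Qed.

Lemma nat_walk_len_le L L' x p : (forall a, (L a <= L' a)%N) ->
  (nat_walk_len L x p <= nat_walk_len L' x p)%N.
Proof. by move=> le; elim: p x => //= y p IH x; rewrite leq_add. Qed.

Definition nat_ball L v r : {set V} :=
  [set u | `[< exists p, [/\ path e v p, last v p = u & (nat_walk_len L v p <= r)%N] >]]%SET.

Lemma nat_ballP L v r u :
  reflect (exists p, [/\ path e v p, last v p = u & (nat_walk_len L v p <= r)%N])
    (u \in nat_ball L v r).
Proof. by rewrite inE; exact: asboolP. Qed.

Lemma nat_ball_center L v r : v \in nat_ball L v r.
Proof. by apply/nat_ballP; exists [::]. Qed.

Lemma nat_ball_leq L v r r' :
  (r <= r')%N -> nat_ball L v r \subset nat_ball L v r'.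
Proof.
move=> le; apply/fintype.subsetP => u /nat_ballP[p [pp lp wp]].
by apply/nat_ballP; exists p; split => //; exact: leq_trans le.
Qed.

Lemma nat_ball_lengths_le L L' v r u : (forall a, (L a <= L' a)%N) ->
  u \in nat_ball L' v r -> u \in nat_ball L v r.
Proof.
move=> le /nat_ballP[p [pp lp wp]].
by apply/nat_ballP; exists p; split => //; apply: leq_trans wp; exact: nat_walk_len_le.
Qed.

Lemma nat_ball_step L v r x y : x \in nat_ball L v r -> e x y ->
  y \in nat_ball L v (r + L [set x; y]%SET).
Proof.
move=> /nat_ballP[p [pp lp wp]] exy; apply/nat_ballP; exists (rcons p y).
split; first by rewrite rcons_path pp lp.
  by rewrite last_rcons.
by rewrite -cats1 nat_walk_len_cat lp /= addn0 leq_add2r.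
Qed.

Lemma cut_edge U x y : e x y -> x \in U -> y \notin U ->
  [set x; y]%SET \in Defs.cut e U.
Proof.
move=> exy xU yU; rewrite inE (edge_mem exy) /=.
have -> : ([set x; y] :&: U)%SET = [set x]%SET; last by rewrite cards1.
apply/finset.setP => z; rewrite !inE.
have [->|zx] := eqVneq z x; first by rewrite xU.
by have [->|] := eqVneq z y; rewrite ?(negbTE yU).
Qed.

Lemma inner_edge_notin_cut U x y : e x y -> x \in U -> y \in U ->
  [set x; y]%SET \notin Defs.cut e U.
Proof.
move=> exy xU yU; rewrite inE negb_and; apply/orP; right.
have -> : ([set x; y] :&: U)%SET = [set x; y]%SET.
  by apply/finset.setIidPl/fintype.subsetP => z /finset.set2P[]->.
have xy : x != y by apply: contraTneq exy => ->; rewrite e_irr.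
by rewrite cards2 xy.
Qed.

Lemma cut_endpoints U a : a \in Defs.cut e U ->
  exists u u', [/\ u \in U, u' \notin U, e u u' & a = [set u; u']%SET].
Proof.
rewrite inE => /andP[/imsetP [[x y] /= exy ->]].
have [xU|xU] := boolP (x \in U); have [yU|yU] := boolP (y \in U).
- move=> H; have := inner_edge_notin_cut exy xU yU.
  by rewrite inE (edge_mem exy) H.
- by move=> _; exists x, y.
- by move=> _; exists y, x; split=> //; [rewrite e_sym|rewrite finset.setUC].
- have -> : ([set x; y] :&: U)%SET = finset.set0.
    apply/finset.setP => z; rewrite !inE; apply/negP => /andP[/orP[]/eqP ->];
    by rewrite ?(negbTE xU) ?(negbTE yU).
  by rewrite cards0.
Qed.

(* The walks that realise a ball never use its cut. *)
Lemma nat_ball_inner_lengths L L' v t u :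
  (forall a, a \notin Defs.cut e (nat_ball L v t) -> L' a = L a) ->
  u \in nat_ball L v t -> u \in nat_ball L' v t.
Proof.
set U := nat_ball L v t => LE /nat_ballP[p [pp lp wp]].
apply/nat_ballP; exists p; split => //.
(* Here [r] is the length used so far. Every vertex on the walk lies in the ball, so its edges join
   two vertices of [U] and keep their lengths. *)
suff H q x r : path e x q -> x \in nat_ball L v r ->
    (r + nat_walk_len L x q <= t)%N -> nat_walk_len L' x q = nat_walk_len L x q.
  by rewrite (H p v 0%N) // nat_ball_center.
elim: q x r => //= y q IH x r /andP[exy pq] xr le.
have yr := nat_ball_step xr exy.
have xU : x \in U by apply: (fintype.subsetP (@nat_ball_leq L v r t _)) xr; lia.
have yU : y \in U.
  by apply: (fintype.subsetP (@nat_ball_leq L v (r + L [set x; y]%SET) t _)) yr; lia.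
rewrite LE; last exact: inner_edge_notin_cut.
by rewrite (IH y _ pq yr) // -addnA.
Qed.

(** A walk leaving [U] first does so through a cut edge. Up to that point [L] and [L'] agree, so the
    hypothesis on the cut makes the walk longer than [t]. In the application [L'] has the cut
    lengths frozen. *)
Lemma nat_ball_sub L L' v t U : v \in U ->
  (forall a, a \notin Defs.cut e U -> L' a = L a) ->
  (forall a u r, a \in Defs.cut e U -> u \in a -> u \in U ->
     u \in nat_ball L' v r -> (t < r + L a)%N) ->
  nat_ball L v t \subset U.
Proof.
move=> vU LE H; apply/fintype.subsetP => u /nat_ballP[p [pp <- wp]].
suff K q x r : path e x q -> x \in U -> x \in nat_ball L' v r ->
    (r + nat_walk_len L x q <= t)%N -> last x q \in U.
  by apply: (K p v 0%N); rewrite ?nat_ball_center.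
elim: q x r => //= y q IH x r /andP[exy pq] xU xr le.
have [yU|yU] := boolP (y \in U); last first.
  have := H _ x r (cut_edge exy xU yU) (finset.set21 _ _) xU xr; lia.
apply: (IH _ (r + L [set x; y]%SET)%N) => //; last by rewrite -addnA.
rewrite -LE; last exact: inner_edge_notin_cut.
exact: nat_ball_step.
Qed.

End IntegerBalls.

(** * Growth of a ball under memoryless lengths *)

Section BallGrowth.
Context {R : realType} {V : finType} (e : rel V).
Hypotheses (e_sym : symmetric e) (e_irr : irreflexive e).
Variables (T : nat) (p : {set V} -> 'I_T.+2 -> R).
Hypothesis p_ge0 : forall a x, 0 <= p a x.
Hypothesis p_sum1 : forall a, \sum_x p a x = 1.
Local Notation config := {ffun {set V} -> 'I_T.+2}.
Implicit Types (c : config) (v : V) (U : {set V}) (t h : nat).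

Definition lengths c : {set V} -> nat := fun a => c a.

Local Notation ball c v t := (nat_ball e (lengths c) v t).

Variables (h : nat) (k : R).
Hypotheses (k_ge0 : 0 <= k).
(** Memorylessness as an inequality: a length above [s] exceeds [s + h] with conditional probability
    at most [k]. *)
Hypothesis p_tail : forall a s, a \in edges e -> (s + h <= T)%N ->
  \sum_(x : 'I_T.+2 | (s + h < x)%N) p a x <= k * \sum_(x : 'I_T.+2 | (s < x)%N) p a x.

(** Once the lengths off the cut of [U] are fixed, the ball stays equal to [U] as long as no cut
    edge has been crossed. This is a lower bound on each cut length separately, so moving the time
    from [t] to [t + h] costs one factor [k] per cut edge. *)
Lemma ball_stationary_le v U t : (t + h <= T)%N ->
  pr p [pred c | (ball c v t == U) && (ball c v (t + h) == U)] <=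
  k ^+ #|Defs.cut e U| * pr p [pred c | ball c v t == U].
Proof.
move=> thT.
have [vU|vU] := boolP (v \in U); last first.
  rewrite [X in X <= _](_ : _ = 0); first by rewrite mulr_ge0 ?exprn_ge0 ?pr_ge0.
  rewrite /pr big_pred0 // => c /=; apply/negP => /andP[/eqP E _].
  by move: vU; rewrite -E nat_ball_center.
pose C := Defs.cut e U.
pose G : pred config := fun c => U \subset ball c v t.
(* An edge [a] of length [x] is not crossed by time [s], at whatever radius [r] its end in [U] has
   been reached. *)
pose S (s : nat) (c : config) (a : {set V}) : pred 'I_T.+2 := fun x =>
  `[< forall u r, u \in a -> u \in U -> u \in ball c v r -> (s < r + x)%N >].
have frzN c a : a \notin C -> lengths (freeze C ord_max c) a = lengths c a.
  by move=> aC; rewrite /lengths ffunE (negbTE aC).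
(* Freezing at [ord_max], the largest length, can only shrink the balls. *)
have frz_le c a : (lengths c a <= lengths (freeze C ord_max c) a)%N.
  by rewrite /lengths ffunE; case: ifP => // _; rewrite -ltnS ltn_ord.
apply: (@le_trans _ _ (pr p (rectangles C ord_max G (S (t + h)%N)))).
  apply: pr_le => // c /= /andP[/eqP E /eqP E'].
  apply/andP; split.
    apply/fintype.subsetP => u; rewrite -{1}E; apply: nat_ball_inner_lengths => // a.
    by rewrite E; exact: frzN.
  apply/forallP => a; apply/implyP => aC; apply/asboolP => u r ua uU ur.
  have {}ur : u \in ball c v r := nat_ball_lengths_le (frz_le c) ur.
  have [u0 [u' [u0U u'U eu E2]]] := cut_endpoints e_sym e_irr aC.
  have uu0 : u = u0.
    by move: ua; rewrite E2 => /finset.set2P[//|uu']; move: u'U; rewrite -uu' uU.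
  rewrite ltnNge; apply: contra u'U => le.
  rewrite -E'; apply: (fintype.subsetP (nat_ball_leq e _ v le)).
  rewrite -/(lengths c a) E2; apply: nat_ball_step => //.
  by rewrite -uu0.
apply: (@le_trans _ _ (k ^+ #|C| * pr p (rectangles C ord_max G (S t)))); last first.
  rewrite ler_wpM2l ?exprn_ge0 //; apply: pr_le => // c /andP[GU /forallP Sc] /=.
  rewrite finset.eqEsubset; apply/andP; split.
    apply: (@nat_ball_sub _ e e_irr _ (lengths (freeze C ord_max c))) => //.
      by move=> a; exact: frzN.
    move=> a u r aC ua uU ur; have /implyP/(_ aC)/asboolP H := Sc a; exact: H ur.
  apply/fintype.subsetP => u uU; apply: (nat_ball_lengths_le (frz_le c)).
  exact: (fintype.subsetP GU).
apply: pr_rectangle_le => // c a GU aC.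
have [u0 [u' [u0U u'U eu E2]]] := cut_endpoints e_sym e_irr aC.
have ex : exists r, u0 \in ball c v r by exists t; exact: (fintype.subsetP GU).
(* [D] is the distance from [v] to the inner end [u0] of [a]; the side [S s c a] is then the tail
   [s < D + x]. *)
case: (ex_minnP ex) => D uD Dmin.
have Dt : (D <= t)%N by apply: Dmin; exact: (fintype.subsetP GU).
have SE s (x : 'I_T.+2) : S s c a x = (s < D + x)%N.
  apply/asboolP/idP => [H|lt u r].
    by apply: (H u0) => //; rewrite E2 finset.set21.
  rewrite E2 => /finset.set2P[-> _ /Dmin le|->]; last by rewrite (negbTE u'U).
  by apply: leq_trans lt _; rewrite leq_add2r.
rewrite (eq_bigl (fun x : 'I_T.+2 => (t - D + h < x)%N)); last first.
  by move=> x; rewrite SE; apply/idP/idP; lia.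
rewrite [X in _ <= _ * X](eq_bigl (fun x : 'I_T.+2 => (t - D < x)%N)); last first.
  by move=> x; rewrite SE; apply/idP/idP; lia.
apply: p_tail; last by lia.
by move: aC; rewrite inE => /andP[].
Qed.

(** If the ball has at most [n] vertices at time [t + h], then it has fewer than [n] at time [t], or
    exactly [n] at both times and has not changed. The second event is split by the vertex set [U]
    of the ball; the events [ball c v t == U] are disjoint, so [eps] is paid only once. *)
Lemma ball_growth_step v t n (eps : R) : (t + h <= T)%N -> 0 <= eps ->
  (forall U, #|U| = n -> k ^+ #|Defs.cut e U| <= eps) ->
  pr p [pred c | (#|ball c v (t + h)| <= n)%N] <=
  pr p [pred c | (#|ball c v t| < n)%N] + eps.
Proof.
move=> thT eps0 cutn.
apply: (@le_trans _ _ (pr p [pred c | (#|ball c v t| < n)%N ||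
    [&& #|ball c v t| == n & ball c v (t + h) == ball c v t]])).
  apply: pr_le => // c /= le; rewrite ltnNge.
  have sub : ball c v t \subset ball c v (t + h) by apply: nat_ball_leq; exact: leq_addr.
  have := subset_leq_card sub.
  case: (leqP n #|ball c v t|) => //= le2 le3.
  have E : #|ball c v t| = n by apply/eqP; rewrite eqn_leq le2 (leq_trans le3).
  rewrite E eqxx /= eq_sym eqEcard sub /=.
  by rewrite E.
apply: (le_trans (pr_union p_ge0 _ _)); rewrite lerD2l.
rewrite /pr (partition_big (fun c => ball c v t) (fun U => #|U| == n)) /=; last first.
  by move=> c /andP[].
apply: (@le_trans _ _ (\sum_(U : {set V} | #|U| == n)
    eps * pr p [pred c | ball c v t == U])).
  apply: ler_sum => U /eqP Un.
  apply: le_trans (_ : pr p [pred c | (ball c v t == U) && (ball c v (t + h) == U)] <= _).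
    apply: pr_le => // c /= /andP[/andP[_ /eqP ->] ->] //.
  apply: le_trans (ball_stationary_le v U thT) _.
  by rewrite ler_wpM2r ?pr_ge0 // cutn.
rewrite -mulr_sumr ler_piMr //.
apply: le_trans (pr_le1 p_ge0 p_sum1 [pred c | #|ball c v t| == n]).
by rewrite [leRHS]/pr (partition_big (fun c => ball c v t) (fun U => #|U| == n)) //=;
  apply: ler_sum => U /eqP Un; apply: pr_le => // c /= /eqP ->; rewrite Un !eqxx.
Qed.

End BallGrowth.

(** * Doubling the ball in phases *)

Section BallDoubling.
Context {R : realType} {V : finType} (e : rel V).
Hypotheses (e_sym : symmetric e) (e_irr : irreflexive e).
Variables (j : nat).
(** There are [j] phases of [2 ^ j] steps each. Phase [i] leads from [2 ^ i] to [2 ^ i.+1] vertices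
    and allows [2 ^ (j - i)] steps for each new vertex. *)
Let T := (j * 2 ^ j)%N.
Variable (p : {set V} -> 'I_T.+2 -> R).
Hypothesis p_ge0 : forall a x, 0 <= p a x.
Hypothesis p_sum1 : forall a, \sum_x p a x = 1.
Variables (q eps : R).
Hypotheses (q_ge0 : 0 <= q) (eps_ge0 : 0 <= eps).
Hypothesis p_tail : forall a s h, a \in edges e -> (s + h <= T)%N ->
  \sum_(x : 'I_T.+2 | (s + h < x)%N) p a x <=
  q ^+ h * \sum_(x : 'I_T.+2 | (s < x)%N) p a x.
Hypothesis q_cut : forall i (U : {set V}), (i < j)%N ->
  (2 ^ i <= #|U|)%N -> (#|U| <= #|V|./2)%N ->
  (q ^+ (2 ^ (j - i))) ^+ #|Defs.cut e U| <= eps.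

Local Notation ball c v t := (nat_ball e (lengths c) v t).

Let small v t n := pr p [pred c | (#|ball c v t| < minn n (#|V|./2.+1))%N].

Lemma small_ball_step v i m : (i < j)%N -> (m < 2 ^ i)%N ->
  small v (i * 2 ^ j + m.+1 * 2 ^ (j - i)) (2 ^ i + m.+1) <=
  small v (i * 2 ^ j + m * 2 ^ (j - i)) (2 ^ i + m) + eps.
Proof.
move=> ij mi; rewrite /small.
have E2 : (2 ^ j = 2 ^ i * 2 ^ (j - i))%N by rewrite -expnD subnKC // ltnW.
have le : (i * 2 ^ j + m * 2 ^ (j - i) + 2 ^ (j - i) <= T)%N.
  rewrite /T -addnA -mulSnr.
  apply: (@leq_trans (i * 2 ^ j + 2 ^ j)%N); last by rewrite -mulSnr leq_mul2r ij orbT.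
  by rewrite leq_add2l [leqRHS]E2 leq_mul2r mi orbT.
have -> : (i * 2 ^ j + m.+1 * 2 ^ (j - i) = i * 2 ^ j + m * 2 ^ (j - i) + 2 ^ (j - i))%N.
  by rewrite mulSnr addnA.
(* Once the threshold is capped at [#|V|./2.+1], it does not increase any more, and monotonicity of
   the ball in its radius suffices. *)
have [big|le_half] := ltnP #|V|./2 (2 ^ i + m).
  rewrite (minn_idPr _); last by rewrite addnS ltnW.
  rewrite (minn_idPr _) // -[leLHS]addr0 lerD //; apply: pr_le => // c /=.
  by apply: leq_ltn_trans; apply: subset_leq_card; apply: nat_ball_leq; exact: leq_addr.
rewrite addnS (minn_idPl _) ?ltnS // (minn_idPl _); last exact: leqW.
have qh_ge0 : 0 <= q ^+ (2 ^ (j - i)) by rewrite exprn_ge0.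
have tl a s := @p_tail a s (2 ^ (j - i))%N.
apply: (ball_growth_step e_sym e_irr p_ge0 p_sum1 qh_ge0 tl) le eps_ge0 _.
by move=> U UE; apply: q_cut; rewrite ?UE // leq_addr.
Qed.

(** Phase [i] adds [eps] for each of its [2 ^ i] new vertices, so the error bound doubles from phase
    to phase. It may start at phase 0 because the ball contains its centre. *)
Lemma small_ball_le v : small v T (2 ^ j) <= 2 ^+ j * eps.
Proof.
suff H i : (i <= j)%N -> small v (i * 2 ^ j) (2 ^ i) <= 2 ^+ i * eps by exact: H.
elim: i => [_|i IH ij].
  rewrite /small (minn_idPl _) // /pr big_pred0 ?mulr_ge0 ?exprn_ge0 // => c /=.
  apply/negP; rewrite mul0n ltnS leqn0 cards_eq0 => /eqP E.
  by have := nat_ball_center e (lengths c) v 0; rewrite E inE.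
have K m : (m <= 2 ^ i)%N -> small v (i * 2 ^ j + m * 2 ^ (j - i)) (2 ^ i + m) <=
    (2 ^+ i + m%:R) * eps.
  elim: m => [_|m IHm mi]; first by rewrite mul0n !addn0 addr0 IH // ltnW.
  apply: le_trans (small_ball_step v ij mi) _.
  by rewrite -[m.+1%:R]natr1 addrA mulrDl mul1r lerD2r IHm // ltnW.
have -> : (i.+1 * 2 ^ j = i * 2 ^ j + 2 ^ i * 2 ^ (j - i))%N.
  by rewrite -expnD subnKC ?mulSnr // ltnW.
have -> : (2 ^ i.+1 = 2 ^ i + 2 ^ i)%N by rewrite expnS mul2n addnn.
have -> : 2 ^+ i.+1 = 2 ^+ i + (2 ^ i)%:R :> R.
  by rewrite natrX exprS mulr_natl mulr2n.
exact: K.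
Qed.

End BallDoubling.

(** * Finite-valued random variables and exponential tails *)

Section FiniteValued.
Context {disp : measure_display} {Omega : measurableType disp} {R : realType}.
Variable P : probability Omega R.
Context {J : finType}.
Variable F : Omega -> J.
Hypothesis mF : forall x, measurable [set o | F o = x]%classic.

Lemma finite_valued_seq (s : seq J) : uniq s ->
  measurable [set o | F o \in s]%classic /\
  P [set o | F o \in s]%classic = (\sum_(x <- s) P [set o | F o = x]%classic)%E.
Proof.
elim: s => [_|x s IH /= /andP[xs /IH[ms Es]]].
  by rewrite big_nil (_ : [set _ | _]%classic = classical_sets.set0) ?measure0 //; apply/seteqP; split.
have E : [set o | F o \in x :: s]%classic =
    ([set o | F o = x] `|` [set o | F o \in s])%classic.
  apply/seteqP; split => o /=; rewrite inE.
    by move=> /orP[/eqP|]; [left|right].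
  by move=> [->|->]; rewrite ?eqxx ?orbT.
rewrite E; split; first exact: measurableU.
rewrite big_cons -Es; apply: measureU => //.
by apply/seteqP; split => o //= [->]; rewrite (negbTE xs).
Qed.

Let finite_valued_setE (B : pred J) :
  [set o | B (F o)]%classic = [set o | F o \in [seq x <- enum J | B x]]%classic.
Proof. by apply/seteqP; split => o /=; rewrite mem_filter mem_enum andbT. Qed.

Lemma measurable_finite_valued (B : pred J) : measurable [set o | B (F o)]%classic.
Proof.
rewrite finite_valued_setE.
by have [] := finite_valued_seq (filter_uniq B (enum_uniq J)).
Qed.

Lemma probability_finite_valued (B : pred J) :
  P [set o | B (F o)]%classic = (\sum_(x | B x) P [set o | F o = x]%classic)%E.
Proof.
rewrite finite_valued_setE.
have [_ ->] := finite_valued_seq (filter_uniq B (enum_uniq J)).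
by rewrite big_filter big_enum_cond.
Qed.

End FiniteValued.

Section ExponentialTail.
Context {disp : measure_display} {Omega : measurableType disp} {R : realType}.
Variables (P : probability Omega R) (X : {RV P >-> R}).
Hypothesis X_exp : forall B : set R, measurable B ->
  distribution P X B = exponential_prob 1 B.

Lemma exponential_lt0 : P (X @^-1` `]-oo, 0[)%classic = 0%E.
Proof.
rewrite -[LHS]/(distribution P X _) X_exp; last exact: measurable_itv.
rewrite /exponential_prob integral0_eq // => x.
by rewrite /= in_itv /= => x0; rewrite lt0_exponential_pdf.
Qed.

Lemma exponential_ge (s : R) : 0 <= s ->
  P (X @^-1` `[s, +oo[)%classic = (expR (- s))%:E.
Proof.
move=> s0.
have mX (B : set R) : measurable B -> measurable (X @^-1` B)%classic.
  by move=> mB; rewrite -[X in measurable X]setTI; exact: measurable_funP.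
suff lt_s : P (X @^-1` `]-oo, s[)%classic = (1 - (expR (- s))%:E)%E.
  have -> : (X @^-1` `[s, +oo[ = ~` (X @^-1` `]-oo, s[))%classic.
    apply/seteqP; split => o /=; rewrite !in_itv /= ?andbT => H.
      by apply/negP; rewrite -leNgt.
    by rewrite leNgt; apply/negP.
  rewrite probability_setC; last by apply: mX; exact: measurable_itv.
  by rewrite lt_s -!EFinB; congr EFin; lra.
move: s0; rewrite le_eqVlt => /orP[/eqP <-|s0].
  by rewrite exponential_lt0 oppr0 expR0 subee.
(* The negative half-line is null, and on the rest the integral of the density is explicit. *)
have -> : (X @^-1` `]-oo, s[ = X @^-1` `]-oo, 0[ `|` X @^-1` `[0%R, s[)%classic.
  apply/seteqP; split => o /=; rewrite !in_itv /=.
    by move=> H; case: (ltP (X o) 0) => h; [left|right; rewrite H].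
  by case=> [H|/andP[]//]; exact: lt_trans s0.
have m0 : measurable (X @^-1` `]-oo, 0%R[)%classic by apply: mX; exact: measurable_itv.
have m1 : measurable (X @^-1` `[0%R, s[)%classic by apply: mX; exact: measurable_itv.
apply: (etrans (measureU P m0 m1 _)).
  apply/seteqP; split => o //=; rewrite !in_itv /= => -[h /andP[h' _]].
  by move: h; rewrite ltNge h'.
apply: (etrans (congr2 (fun a b => a + b)%E exponential_lt0 (X_exp (measurable_itv `[0%R, s[)))).
rewrite add0e.
rewrite /exponential_prob integral_itv_bndo_bndc.
  by have := @exponential_prob_itv0c R 1 s s0; rewrite /exponential_prob mulN1r.
apply/measurable_EFinP; apply: measurable_funTS.
exact: measurable_exponential_pdf.
Qed.

End ExponentialTail.

(** * Rounding the weights to a grid *)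

Lemma sum_ltn_ord (n m : nat) : (\sum_(k < n) (k < m)%N)%N = minn m n.
Proof.
elim: n => [|n IH]; first by rewrite big_ord0 minn0.
by rewrite big_ord_recr /= IH; case: (ltnP n m) => /=; lia.
Qed.

Section Discretization.
Context {R : realType} (y : R) (T : nat).
Hypothesis y_ge0 : 0 <= y.

(* [floor (s / y) + 1] for [0 <= s], truncated at [T + 1]. *)
Definition grid_count (s : R) : nat := (\sum_(i < T.+1) (i%:R * y <= s)%R)%N.

Lemma grid_count_lt s : (grid_count s < T.+2)%N.
Proof.
rewrite ltnS -[leqRHS]card_ord -sum1_card; apply: leq_sum => i _.
exact: leq_b1.
Qed.

Definition grid_level (s : R) : 'I_T.+2 := Ordinal (grid_count_lt s).

(** The grid points not above [s] form an initial segment, so their number exceeds [i] exactly when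
    the point of index [i] is one of them. *)
Lemma grid_level_gt (i : nat) (s : R) : (i <= T)%N ->
  (i < grid_level s)%N = (i%:R * y <= s).
Proof.
move=> iT /=; apply/idP/idP; last first.
  move=> le; apply: (@leq_trans (\sum_(k < T.+1) (k < i.+1)%N)%N).
    by rewrite sum_ltn_ord leq_min leqnn.
  apply: leq_sum => k _; case: (ltnP k i.+1) => //= ki.
  by rewrite lt0b (le_trans _ le) // ler_wpM2r // ler_nat.
apply: contraTT; rewrite -ltNge -leqNgt => lt.
apply: (@leq_trans (\sum_(k < T.+1) (k < i)%N)%N); last first.
  by rewrite sum_ltn_ord geq_minl.
apply: leq_sum => k _; case: (ltnP k i) => //= ki; first exact: leq_b1.
by rewrite leqn0 eqb0 -ltNge (lt_le_trans lt) // ler_wpM2r // ler_nat.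
Qed.

Let measurable_level_gt (i : nat) : measurable [set s : R | (i < grid_level s)%N]%classic.
Proof.
have [iT|iT] := leqP i T.
  rewrite (_ : [set _ | _]%classic = `[i%:R * y, +oo[%classic); first exact: measurable_itv.
  by apply/seteqP; split => s; rewrite /mkset grid_level_gt // in_itv /= andbT.
rewrite (_ : [set _ | _]%classic = classical_sets.set0) //.
apply/seteqP; split => // s; rewrite /mkset => h.
by have := grid_count_lt s; rewrite ltnS leqNgt (leq_trans _ h).
Qed.

Lemma measurable_grid_level (x : 'I_T.+2) :
  measurable [set s : R | grid_level s = x]%classic.
Proof.
have m0 : measurable [set s : R | (x <= grid_level s)%N]%classic.
  case: x => [[|i] iT] /=; last exact: measurable_level_gt.
  by rewrite (_ : [set _ | _]%classic = setT) //; apply/seteqP; split.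
have -> : [set s : R | grid_level s = x]%classic =
    ([set s : R | (x <= grid_level s)%N] `\` [set s : R | (x < grid_level s)%N])%classic.
  apply/seteqP; split => s /=.
    by move=> /(congr1 val) /= ->; rewrite leqnn ltnn.
  by case=> h /negP; rewrite -leqNgt => h'; apply/val_inj/eqP; rewrite eqn_leq /= h h'.
by apply: measurableD => //; exact: measurable_level_gt.
Qed.

End Discretization.

Section DiscretizedWeights.
Context {R : realType} {V : finType} (e : rel V).
Context {disp : measure_display} {Omega : measurableType disp}.
Variables (P : probability Omega R) (w : {set V} -> {RV P >-> R}).
Hypothesis w_iid : iid_exponential (edges e) w.
Variables (y : R) (T : nat).
Hypothesis y_ge0 : 0 <= y.

Local Notation level := (grid_level y T).

Lemma weight_ge a (s : R) : a \in edges e -> 0 <= s ->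
  P [set o | s <= w a o]%classic = (expR (- s))%:E.
Proof.
move=> aE s0; have := exponential_ge (fun B => w_iid.2 a aE B) s0.
by congr (P _ = _); apply/seteqP; split => o /=; rewrite in_itv /= andbT.
Qed.

Lemma measurable_weight a (B : set R) : measurable B ->
  measurable [set o | B (w a o)]%classic.
Proof.
move=> mB; have := @measurable_funPT _ _ _ _ (w a) measurableT B mB.
by rewrite setTI.
Qed.

Lemma measurable_level a x : measurable [set o | level (w a o) = x]%classic.
Proof. exact: measurable_weight (measurable_grid_level y_ge0 x). Qed.

(** Vertex sets that are not edges get a point mass at [ord0], so that the product may run over all
    vertex sets. *)
Definition level_law (a : {set V}) (x : 'I_T.+2) : R :=
  if a \in edges e then fine (P [set o | level (w a o) = x]%classic)
  else (x == ord0)%:R.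

Lemma level_lawE a x : a \in edges e ->
  (level_law a x)%:E = P [set o | level (w a o) = x]%classic.
Proof.
by move=> aE; rewrite /level_law aE fineK // fin_num_measure //; exact: measurable_level.
Qed.

Lemma level_law_ge0 a x : 0 <= level_law a x.
Proof. by rewrite /level_law; case: ifP => _; rewrite ?fine_ge0 ?ler0n. Qed.

Lemma sum_level_lawE a (B : pred 'I_T.+2) : a \in edges e ->
  (\sum_(x | B x) level_law a x)%:E = P [set o | B (level (w a o))]%classic.
Proof.
move=> aE; rewrite (probability_finite_valued P (measurable_level a) B) -sumEFin.
by apply: eq_bigr => x _; rewrite level_lawE.
Qed.

Lemma level_law_sum1 a : \sum_x level_law a x = 1.
Proof.
have [aE|aE] := boolP (a \in edges e); last first.
  rewrite (bigD1 ord0) //= big1 ?addr0 /level_law ?(negbTE aE) ?eqxx // => x.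
  by move=> /negbTE ->.
apply: EFin_inj; rewrite sum_level_lawE //.
by rewrite (_ : [set _ | _]%classic = setT) ?probability_setT //; apply/seteqP; split.
Qed.

(** The tail is exactly geometric in [s], which is the memorylessness used for the growth of balls;
    the truncation at [T + 1] is invisible for [s <= T]. *)
Lemma level_law_tail a (s : nat) : a \in edges e -> (s <= T)%N ->
  \sum_(x : 'I_T.+2 | (s < x)%N) level_law a x = expR (- (s%:R * y)).
Proof.
move=> aE sT; apply: EFin_inj; rewrite sum_level_lawE // -(weight_ge aE) ?mulr_ge0 //.
by congr (P _); apply/seteqP; split => o; rewrite /mkset grid_level_gt.
Qed.

Definition level_config (o : Omega) : {ffun {set V} -> 'I_T.+2} :=
  [ffun a => if a \in edges e then level (w a o) else ord0].

Let config_fiber (c : {ffun {set V} -> 'I_T.+2}) : (forall a, a \notin edges e -> c a = ord0) ->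
  [set o | level_config o = c]%classic =
  [set o | forall a, a \in edges e -> level (w a o) = c a]%classic.
Proof.
move=> c0; apply/seteqP; split => o /=.
  by move=> /ffunP H a aE; have := H a; rewrite ffunE aE.
by move=> H; apply/ffunP => a; rewrite ffunE; case: ifPn => [/H|/c0].
Qed.

Let config_fiber0 (c : {ffun {set V} -> 'I_T.+2}) a : a \notin edges e -> c a != ord0 ->
  [set o | level_config o = c]%classic = classical_sets.set0.
Proof.
move=> aE ca; apply/seteqP; split => // o /= /ffunP/(_ a).
by rewrite ffunE (negbTE aE) => h; rewrite -h eqxx in ca.
Qed.

Lemma measurable_level_config (c : {ffun {set V} -> 'I_T.+2}) : measurable [set o | level_config o = c]%classic.
Proof.
have [/existsP[a /andP[aE ca]]|] := boolP [exists a, (a \notin edges e) && (c a != ord0)].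
  by rewrite (config_fiber0 aE ca).
rewrite negb_exists => /forallP c0.
rewrite config_fiber; last first.
  by move=> a aE; have := c0 a; rewrite aE /= negbK => /eqP.
rewrite (_ : [set _ | _]%classic =
  (\bigcap_(a in [set` edges e]) [set o | level (w a o) = c a])%classic).
  by apply: fin_bigcap_measurable => // a _; exact: measurable_level.
by apply/seteqP; split.
Qed.

Lemma level_config_law (c : {ffun {set V} -> 'I_T.+2}) :
  P [set o | level_config o = c]%classic = (product_law level_law c)%:E.
Proof.
(* A nonzero level at a non-edge makes both the event empty and the product 0. *)
have [/existsP[a /andP[aE ca]]|] := boolP [exists a, (a \notin edges e) && (c a != ord0)].
  rewrite (config_fiber0 aE ca) measure0 /product_law (bigD1 a) //=.
  by rewrite {1}/level_law (negbTE aE) (negbTE ca) mul0r.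
rewrite negb_exists => /forallP c0.
have {}c0 a : a \notin edges e -> c a = ord0.
  by move=> aE; have := c0 a; rewrite aE /= negbK => /eqP.
rewrite config_fiber //.
have := w_iid.1 (edges e) (fun a => [set s | level s = c a]%classic) (subxx _).
move=> ->; last by move=> a; exact: measurable_grid_level.
rewrite /product_law [in RHS](bigID (mem (edges e))) /= [X in _ * X]big1 ?mulr1; last first.
  by move=> a aE; rewrite /level_law (negbTE aE) c0 ?eqxx.
rewrite -prodEFin; apply: eq_bigr => a aE; rewrite level_lawE //.
Qed.

Lemma measurable_level_config_event (A : pred {ffun {set V} -> 'I_T.+2}) :
  measurable [set o | A (level_config o)]%classic.
Proof. exact: (measurable_finite_valued P measurable_level_config). Qed.

Lemma level_config_pr (A : pred {ffun {set V} -> 'I_T.+2}) :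
  P [set o | A (level_config o)]%classic = (pr level_law A)%:E.
Proof.
rewrite (probability_finite_valued P measurable_level_config) -sumEFin.
by apply: eq_bigr => c _; rewrite level_config_law.
Qed.

(** Levels round up: an edge of level [l <= T] has weight below [l * y]. The bound [r <= T] keeps
    edges of the truncated level [T + 1] out of the walk. *)
Lemma level_ball_dist (o : Omega) v u r :
  (forall a, a \in edges e -> 0 <= w a o) ->
  (r <= T)%N -> u \in nat_ball e (lengths (level_config o)) v r ->
  sp_dist e (fun a => w a o) v u <= r%:R * y.
Proof.
move=> w0 rT /nat_ballP[p [pp lp wp]].
rewrite -lp.
have := @sp_dist_le _ _ e (fun a => w a o) w0 v p pp.
move=> /le_trans; apply.
apply: (@le_trans _ _ ((nat_walk_len (lengths (level_config o)) v p)%:R * y)); last first.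
  by rewrite ler_wpM2r // ler_nat.
have {rT lp}wT := leq_trans wp rT; move: {wp} v pp wT.
elim: p => [|x p IH] v /=; first by rewrite path_weightE walk_len_nil mul0r.
case/andP => evx pp le; rewrite path_weightE walk_len_cons natrD mulrDl lerD //; last first.
  by apply: IH => //; lia.
have aE := edge_mem evx.
have {}le : (lengths (level_config o) [set v; x]%SET <= T)%N by lia.
rewrite ltW // ltNge; move: le; rewrite /lengths ffunE aE => le.
by rewrite -(grid_level_gt y_ge0 _ le) ltnn.
Qed.

End DiscretizedWeights.

(** * The cut parameters *)

Lemma crossing_edge (V : finType) (e : rel V) (U : {set V}) x p :
  path e x p -> x \in U -> last x p \notin U ->
  exists u u', [/\ e u u', u \in U & u' \notin U].
Proof.
elim: p x => [|y p IH] x /=; first by move=> _ ->.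
case/andP => exy pp xU lU; have [yU|yU] := boolP (y \in U).
  exact: IH pp yU lU.
by exists x, y.
Qed.

Section CutParameters.
Context {R : realType} {V : finType} (e : rel V).
Hypothesis V_gt1 : (1 < #|V|)%N.
Implicit Types (U : {set V}).
Local Notation alpha := (@Defs.alpha R V e).
Local Notation beta := (@Defs.beta R V e).

Lemma mu_cut_gt0 U : (0 < #|U| < #|V|)%N -> (0 < mu_cut U)%N.
Proof. by case/andP => U0 UV; rewrite /mu_cut muln_gt0 U0 subn_gt0. Qed.

Let ratio_ge0 U : 0 <= cut_ratio e U :> R.
Proof. by rewrite /cut_ratio divr_ge0 ?ler0n. Qed.

Lemma cut_ratios_lbound : has_lbound (@cut_ratios R V e).
Proof. by exists 0 => _ [U _ <-]. Qed.

Lemma cut_ratios_ubound : has_ubound (@cut_ratios R V e).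
Proof.
exists #|edges e|%:R => _ [U /= /mu_cut_gt0 mu0 <-].
rewrite /cut_ratio ler_pdivrMr ?ltr0n // -natrM ler_nat.
apply: (@leq_trans #|edges e|); last by rewrite leq_pmulr.
by apply: subset_leq_card; apply/fintype.subsetP => a; rewrite inE => /andP[].
Qed.

Lemma alpha_le_cut U : (0 < #|U| < #|V|)%N ->
  alpha * (mu_cut U)%:R <= #|Defs.cut e U|%:R.
Proof.
move=> HU; rewrite -ler_pdivlMr ?ltr0n ?mu_cut_gt0 //.
by apply: ge_inf; [exact: cut_ratios_lbound | exists U].
Qed.

Lemma beta_ge_cut U : (0 < #|U| < #|V|)%N ->
  #|Defs.cut e U|%:R <= beta * (mu_cut U)%:R.
Proof.
move=> HU; rewrite -ler_pdivrMr ?ltr0n ?mu_cut_gt0 //.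
by apply: ub_le_sup; [exact: cut_ratios_ubound | exists U].
Qed.

Lemma proper_singleton (v : V) : (0 < #|[set v]%SET| < #|V|)%N.
Proof. by rewrite cards1 V_gt1. Qed.

Lemma ex_vertex : exists v : V, True.
Proof. by have /card_gt0P[v _] : (0 < #|V|)%N by exact: ltnW; exists v. Qed.

Lemma alpha_le_beta : alpha <= beta.
Proof.
have [v _] := ex_vertex.
have mu0 := mu_cut_gt0 (proper_singleton v).
rewrite -(ler_pM2r (_ : 0 < (mu_cut [set v]%SET)%:R)) ?ltr0n //.
exact: le_trans (alpha_le_cut (proper_singleton v)) (beta_ge_cut (proper_singleton v)).
Qed.

(** By connectivity every cut of a nonempty proper [U] contains an edge, so all ratios are at least
    the inverse of [#|V| * #|V|], and so is their infimum. *)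
Lemma alpha_gt0 : (forall u v, connect e u v) -> 0 < alpha.
Proof.
move=> econn; have n0 : 0 < (#|V| * #|V|)%:R :> R by rewrite ltr0n muln_gt0 ltnW.
apply: (@lt_le_trans _ _ ((#|V| * #|V|)%:R^-1)); first by rewrite invr_gt0.
have [v _] := ex_vertex.
apply: lb_le_inf; first by exists (cut_ratio e [set v]%SET), [set v]%SET => //; exact: proper_singleton.
move=> _ [U /= HU <-]; have mu0 := mu_cut_gt0 HU.
have cut0 : (0 < #|Defs.cut e U|)%N.
  have /andP[/card_gt0P[x xU] UV] := HU.
  have /card_gt0P[z] : (0 < #|~: U|)%N by rewrite cardsCs finset.setCK subn_gt0.
  rewrite inE => zU; have /connectP[p pp lp] := econn x z.
  have [|u [u' [eu uU u'U]]] := crossing_edge pp xU; first by rewrite -lp.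
  by apply/card_gt0P; exists [set u; u']%SET; exact: cut_edge.
rewrite /cut_ratio ler_pdivlMr ?ltr0n // ler_pdivrMl //.
rewrite -natrM ler_nat; apply: (@leq_trans (#|V| * #|V|)); last by rewrite leq_pmulr.
by rewrite /mu_cut leq_mul // ?leq_subr // max_card.
Qed.

End CutParameters.

(** * Probability of a small ball at each scale *)

Section SmallBalls.
Context {R : realType} {V : finType} (e : rel V).
Hypotheses (e_sym : symmetric e) (e_irr : irreflexive e).
Hypotheses (e_conn : forall u v, connect e u v) (V_gt1 : (1 < #|V|)%N).
Context {disp : measure_display} {Omega : measurableType disp}.
Variables (P : probability Omega R) (w : {set V} -> {RV P >-> R}).
Hypothesis w_iid : iid_exponential (edges e) w.

Local Notation alpha := (@Defs.alpha R V e).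
Local Notation n := #|V|.

Let a_gt0 : 0 < alpha := alpha_gt0 V_gt1 e_conn.
Let n_gt0 : 0 < n%:R :> R. Proof. by rewrite ltr0n ltnW. Qed.
Let pow_gt0 j : 0 < 2 ^+ j :> R. Proof. by rewrite exprn_gt0. Qed.

(* At scale [j] the mesh is chosen so that, while the ball has between [2 ^ i] and
   [2 ^ i.+1] vertices, it fails to grow during [2 ^ (j - i)] steps with
   probability at most [expR (- 2 j)]. *)
Definition mesh (j : nat) : R := 4 * j%:R / (alpha * n%:R * 2 ^+ j).

Definition scale_radius (j : nat) : R := 4 * j%:R ^+ 2 / (alpha * n%:R).

Lemma mesh_ge0 j : 0 <= mesh j.
Proof.
by rewrite /mesh divr_ge0 ?mulr_ge0 ?ler0n // ?exprn_ge0 // ?ltW.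
Qed.

Lemma scale_radiusE j : (j * 2 ^ j)%:R * mesh j = scale_radius j.
Proof.
rewrite /mesh /scale_radius natrM natrX; have := pow_gt0 j; have := a_gt0; have := n_gt0.
by move=> /lt0r_neq0 h1 /lt0r_neq0 h2 /lt0r_neq0 h3; field; rewrite ?h1 ?h2 ?h3.
Qed.

(** Stated with rounded weights, so that it depends on finitely many levels only. Rounded balls lie
    inside the true ones when the weights are nonnegative, so a vertex outside this set has a large
    true ball. *)
Definition small_ball_vertices (j : nat) (o : Omega) : {set V} :=
  [set v | (#|nat_ball e (lengths (level_config e w (mesh j) (j * 2 ^ j) o)) v (j * 2 ^ j)|
            < minn (2 ^ j) n./2.+1)%N]%SET.

Lemma measurable_small_ball j v : measurable [set o | v \in small_ball_vertices j o]%classic.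
Proof.
rewrite (_ : [set _ | _]%classic = [set o | [pred c |
  (#|nat_ball e (lengths c) v (j * 2 ^ j)| < minn (2 ^ j) n./2.+1)%N]
    (level_config e w (mesh j) (j * 2 ^ j) o)]%classic).
  exact: (measurable_level_config_event e w (mesh_ge0 j)).
by apply/seteqP; split => o /=; rewrite inE.
Qed.

Lemma small_ball_probability j v :
  (P [set o | v \in small_ball_vertices j o]%classic <= (2 ^- j)%:E)%E.
Proof.
rewrite (_ : [set _ | _]%classic = [set o | [pred c |
  (#|nat_ball e (lengths c) v (j * 2 ^ j)| < minn (2 ^ j) n./2.+1)%N]
    (level_config e w (mesh j) (j * 2 ^ j) o)]%classic); last first.
  by apply/seteqP; split => o /=; rewrite inE.
rewrite (level_config_pr w_iid (mesh_ge0 j)) lee_fin.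
set q := expR (- mesh j); pose eps := expR (- (2 * j%:R)) : R.
apply: (@le_trans _ _ (2 ^+ j * eps)).
  apply: (@small_ball_le _ _ e e_sym e_irr j _ _ _ q eps).
  - exact: level_law_ge0.
  - by move=> a; apply: level_law_sum1; exact: mesh_ge0.
  - exact: expR_ge0.
  - exact: expR_ge0.
  - move=> a s h aE le; rewrite !(level_law_tail w_iid (mesh_ge0 j) aE) //; last first.
      exact: leq_trans (leq_addr _ _) le.
    by rewrite /q -expRM_natl -expRD natrD ler_expR; lra.
  - move=> i U ij Ui Un; rewrite -exprM /q -expRM_natl ler_expR.
    have U0 : (0 < #|U|)%N by apply: leq_trans Ui; rewrite expn_gt0.
    have Ult : (#|U| < n)%N by have := odd_double_half n; rewrite -addnn; lia.
    have cutU : alpha * (mu_cut U)%:R <= #|Defs.cut e U|%:R.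
      by apply: alpha_le_cut; rewrite U0.
    (* From [2 ^ i <= #|U|] and [n / 2 <= n - #|U|]. The cut thus has at least
       [alpha * 2 ^ i * n / 2] edges, and multiplication by [2 ^ (j - i) * mesh j] gives exactly
       [2 * j]. *)
    have muU : 2 ^+ i * n%:R / 2 <= (mu_cut U)%:R :> R.
      rewrite ler_pdivrMr // -natrX -!natrM ler_nat /mu_cut.
      by have := odd_double_half n; rewrite -addnn; nia.
    have E2 : 2 ^+ j = 2 ^+ (j - i) * 2 ^+ i :> R by rewrite -exprD subnK // ltnW.
    rewrite mulrN lerN2 natrM natrX.
    have H1 : alpha * (2 ^+ i * n%:R / 2) <= #|Defs.cut e U|%:R.
      by apply: le_trans cutU; rewrite ler_pM2l.
    have c0 : 0 <= 2 ^+ (j - i) * mesh j by rewrite mulr_ge0 ?mesh_ge0 // ltW.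
    rewrite [leRHS]mulrAC; apply: le_trans (ler_wpM2l c0 H1).
    rewrite le_eqVlt; apply/orP; left; apply/eqP.
    rewrite /mesh E2; have := pow_gt0 i; have := pow_gt0 (j - i); have := a_gt0; have := n_gt0.
    by move=> /lt0r_neq0 h1 /lt0r_neq0 h2 /lt0r_neq0 h3 /lt0r_neq0 h4; field; rewrite ?h1 ?h2 ?h3 ?h4.
(* [2 ^ j * eps <= 2 ^- j] amounts to a power of [2 <= expR 1]. *)
rewrite /eps expRN ler_pdivrMr ?expR_gt0 // mulrC ler_pdivlMr // -exprD.
have -> : 2 * j%:R = (j + j)%:R * 1 :> R by rewrite natrD; ring.
rewrite expRM_natl lerXn2r ?nnegrE ?expR_ge0 //.
by have := expR_ge1Dx (1 : R); lra.
Qed.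

End SmallBalls.

(** * Light edges forced by a short tour *)

Lemma next_neq (T : eqType) (t : seq T) u :
  uniq t -> (1 < size t)%N -> u \in t -> next t u != u.
Proof.
move=> ut st ut'; case: (rot_to ut') => i s E.
rewrite -(next_rot i ut) E; move: ut st; rewrite -(rot_uniq i) -(size_rot i) E.
case: s {E} => //= y s /andP[us _] _; rewrite eqxx.
by apply: contraNneq us => ->; rewrite mem_head.
Qed.

Section LightEdges.
Context {R : realType} {V : finType} (e : rel V) (w : {set V} -> R).
Hypotheses (e_sym : symmetric e) (e_conn : forall u v, connect e u v).
Hypothesis V_gt1 : (1 < #|V|)%N.
Hypothesis w_ge0 : forall a, a \in edges e -> 0 <= w a.

Lemma card_edge_le2 a : a \in edges e -> (#|a| <= 2)%N.
Proof. by case/imsetP => -[x y] /= _ ->; rewrite cards2; case: (_ != _). Qed.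

(* A tour of length below [x] has more than half of its distances below the mean
   value [2 * x / n]; each one yields a light edge, used at most twice. *)
Lemma tsp_lt_light_edges (x : R) : 0 < x -> tsp (sp_dist e w) < x ->
  (#|V| %/ 4 < #|[set a in edges e | (w a < 2 * x / #|V|%:R)%R]%SET|)%N.
Proof.
move=> x0; set y := 2 * x / _; set L := finset.finset _.
have n0 : 0 < #|V|%:R :> R by rewrite ltr0n ltnW.
have y0 : 0 < y by rewrite /y divr_gt0 ?mulr_gt0.
have tour0 : ([set tour_length (sp_dist e w) t | t in
    [set t | is_tour [set: V]%SET t]] !=set0)%classic.
  exists (tour_length (sp_dist e w) (enum V)), (enum V) => //; split.
    exact: enum_uniq.
  by move=> z; rewrite mem_enum !inE.
move=> /(inf_lt tour0)[_ [t /= [ut tE] <-] lt].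
set A := [set u | sp_dist e w u (next t u) < y]%SET.
have tsize : size t = #|V|.
  by rewrite -(card_uniqP ut); apply: eq_card => z; rewrite tE inE.
(* Otherwise at least half of the vertices have a successor at distance at least [y = 2 * x / n],
   and these distances alone add up to [x]. *)
have Ax : (#|V| < 2 * #|A|)%N.
  rewrite ltnNge; apply/negP => Asmall.
  suff : x <= tour_length (sp_dist e w) t by rewrite leNgt lt.
  have perm_t : perm_eq t (enum V).
    by apply: uniq_perm => //; [exact: enum_uniq | move=> z; rewrite tE mem_enum !inE].
  rewrite /tour_length (perm_big _ perm_t) big_enum /=.
  apply: (@le_trans _ _ (\sum_(u | u \notin A) y)); last first.
    rewrite [leRHS](bigID (mem A)) /= -[leLHS]add0r lerD //.
      by apply: sumr_ge0 => u _; exact: sp_dist_ge0.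
    by apply: ler_sum => u; rewrite inE -leNgt.
  rewrite sumr_const -cardsE (_ : [set z | z \notin A]%SET = ~: A)%SET; last first.
    by apply/finset.setP => z; rewrite !inE.
  have -> : x = y * (#|V|%:R / 2) by rewrite /y; field; rewrite ?lt0r_neq0.
  rewrite -[y *+ _]mulr_natr ler_pM2l // ler_pdivrMr // -natrM ler_nat.
  by have := cardsC A; lia.
have AL : A \subset finset.cover L.
  apply/fintype.subsetP => u; rewrite inE => ud.
  have un : u != next t u by rewrite eq_sym next_neq ?tsize // tE inE.
  have [a aE [ua wa]] := sp_dist_lt_edge e_conn w_ge0 un ud.
  by apply/bigcupP; exists a => //; rewrite inE aE.
have : (#|A| <= 2 * #|L|)%N.
  apply: (leq_trans (subset_leq_card AL)).
  apply: (leq_trans (leq_card_cover L)).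
  rewrite mulnC -sum_nat_const; apply: leq_sum => a.
  by rewrite inE => /andP[/card_edge_le2].
move=> AL2; rewrite ltn_divLR //; apply: (leq_trans Ax).
by apply: leq_trans (leq_mul (leqnn 2) AL2) _; rewrite mulnA mulnC.
Qed.

(** Every edge belongs to the cut of a singleton, and each of these [n] cuts has at most [beta * n]
    edges. *)
Lemma card_edges_le : #|edges e|%:R <= @Defs.beta R V e * (#|V|%:R) ^+ 2.
Proof.
have sub : edges e \subset (\bigcup_(v : V) Defs.cut e [set v]%SET)%SET.
  apply/fintype.subsetP => a aE; have /imsetP[[x y] /= exy aD] := aE.
  have [xy|xy] := eqVneq x y; last first.
    apply/bigcupP; exists x => //; rewrite inE aE aD /=.
    rewrite (_ : ([set x; y] :&: [set x])%SET = [set x]%SET) ?cards1 //.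
    by apply/finset.setIidPr; rewrite finset.sub1set finset.set21.
  apply/bigcupP; exists x => //; rewrite inE aE aD -xy finset.setUid /=.
  by rewrite finset.setIid cards1.
have beta0 : 0 <= @Defs.beta R V e.
  exact: le_trans (ltW (alpha_gt0 V_gt1 e_conn)) (alpha_le_beta e V_gt1).
apply: (@le_trans _ _ (\sum_(v : V) #|Defs.cut e [set v]%SET|)%:R).
  rewrite ler_nat; apply: leq_trans (subset_leq_card sub) _.
  elim/big_ind2: _ => [|A m B k Am Bk|v _] //; first by rewrite cards0.
  by apply: leq_trans (leq_add Am Bk); exact: leq_card_setU.
rewrite natr_sum; apply: (@le_trans _ _ (\sum_(v : V) @Defs.beta R V e * #|V|%:R)).
  apply: ler_sum => v _; apply: le_trans (beta_ge_cut e (proper_singleton V_gt1 v)) _.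
  by rewrite ler_wpM2l // ler_nat /mu_cut cards1 mul1n leq_subr.
by rewrite sumr_const -[(_ * _) *+ _]mulr_natr -mulrA -expr2.
Qed.

End LightEdges.

(** * A binomial estimate for the union bound *)

Lemma expn_self_le (R : realType) (k : nat) : (k%:R ^+ k : R) <= 4 ^+ k * k`!%:R.
Proof.
(* From [1 - 1/2 <= expR (- 1/2)], inverted and squared. *)
have expR1_le4 : expR 1 <= 4 :> R.
  have h : 2^-1 <= expR (- 2^-1) :> R by have := expR_ge1Dx (- 2^-1 : R); lra.
  have -> : expR 1 = expR 2^-1 ^+ 2 :> R by rewrite -expRM_natl; congr expR; field.
  have -> : 4 = 2 ^+ 2 :> R by ring.
  rewrite lerXn2r ?nnegrE ?expR_ge0 //.
  by move: h; rewrite expRN lef_pV2 // posrE ?expR_gt0.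
case: k => [|k]; first by rewrite !expr0 fact0 mul1r.
have f0 : 0 < (k.+1)`!%:R :> R by rewrite ltr0n fact_gt0.
rewrite -ler_pdivrMr //.
(* A single term of the exponential series at [k.+1] is at most its sum. *)
have := @expR_ge1Dxn R k.+1%:R k (ler0n _ _).
move=> h; apply: (@le_trans _ _ (expR k.+1%:R)); first by lra.
by rewrite -[X in expR X]mulr1 expRM_natl lerXn2r ?nnegrE ?expR_ge0.
Qed.

Lemma ffact_le_expn (m k : nat) : (m ^_ k <= m ^ k)%N.
Proof.
by elim: k => // k IH; rewrite ffactnSr expnSr leq_mul // leq_subr.
Qed.

Lemma binomial_power_le (R : realType) (m k : nat) (y : R) : 0 <= y -> (0 < k)%N ->
  'C(m, k)%:R * y ^+ k <= (4 * m%:R * y / k%:R) ^+ k.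
Proof.
move=> y0 k0; have f0 : 0 < k`!%:R :> R by rewrite ltr0n fact_gt0.
have k0' : 0 < k%:R ^+ k :> R by rewrite exprn_gt0 // ltr0n.
rewrite expr_div_n !exprMn ler_pdivlMr // [leLHS]mulrAC.
apply: ler_wpM2r; first exact: exprn_ge0.
apply: (@le_trans _ _ ('C(m, k)%:R * (4 ^+ k * k`!%:R))).
  by rewrite ler_wpM2l ?ler0n // expn_self_le.
rewrite mulrCA; apply: ler_wpM2l; first exact: exprn_ge0.
by rewrite -natrM bin_ffact -natrX ler_nat ffact_le_expn.
Qed.

(** * Probability of many light edges *)

Section LightProbability.
Context {R : realType} {V : finType} (e : rel V).
Context {disp : measure_display} {Omega : measurableType disp}.
Variables (P : probability Omega R) (w : {set V} -> {RV P >-> R}).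
Hypothesis w_iid : iid_exponential (edges e) w.

Definition all_light (y : R) (J : {set {set V}}) : set Omega :=
  [set o | forall a, a \in J -> w a o < y]%classic.

Lemma measurable_all_light (y : R) (J : {set {set V}}) : measurable (all_light y J).
Proof.
rewrite (_ : all_light y J = (\bigcap_(a in [set` J]) [set o | w a o < y])%classic).
  apply: fin_bigcap_measurable => // a _.
  apply: (@measurable_weight _ _ _ _ P w a [set s | s < y]%classic).
  rewrite (_ : [set s | _]%classic = `]-oo, y[%classic); first exact: measurable_itv.
  by apply/seteqP; split => s /=; rewrite in_itv.
by apply/seteqP; split.
Qed.

Lemma all_light_le (y : R) (J : {set {set V}}) : 0 <= y -> J \subset edges e ->
  (P (all_light y J) <= (y ^+ #|J|)%:E)%E.
Proof.
move=> y0 JE.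
have mlt : measurable [set s : R | s < y]%classic.
  rewrite (_ : [set s | _]%classic = `]-oo, y[%classic); first exact: measurable_itv.
  by apply/seteqP; split => s /=; rewrite in_itv.
have := w_iid.1 J (fun _ => [set s | s < y]%classic) JE (fun _ => mlt).
rewrite -/(all_light y J) => ->.
(* By independence the probability is a power of [1 - expR (- y)], which is at most [y]. *)
have light_prob a : a \in J ->
    P (w a @^-1` [set s | s < y])%classic = (1 - expR (- y))%:E.
  move=> aJ; have aE := fintype.subsetP JE _ aJ.
  have -> : (w a @^-1` [set s | s < y] = ~` [set o | y <= w a o])%classic.
    apply/seteqP; split => o /=; first by move=> h; apply/negP; rewrite -ltNge.
    by rewrite ltNge => /negP.
  rewrite probability_setC; last first.
    apply: (@measurable_weight _ _ _ _ P w a [set s | y <= s]%classic).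
    rewrite (_ : [set s | _]%classic = `[y, +oo[%classic); first exact: measurable_itv.
    by apply/seteqP; split => s /=; rewrite in_itv /= andbT.
  by rewrite (weight_ge w_iid aE y0) -EFinB.
rewrite (eq_bigr _ light_prob) prodEFin lee_fin prodr_const lerXn2r ?nnegrE //.
  by rewrite subr_ge0 -expR0 ler_expR oppr_le0.
by have := expR_ge1Dx (- y); lra.
Qed.

Lemma probability_exists_le (J : finType) (F : J -> set Omega) (s : seq J) :
  (forall x, measurable (F x)) ->
  measurable [set o | exists2 x, x \in s & F x o]%classic /\
  (P [set o | exists2 x, x \in s & F x o]%classic <= \sum_(x <- s) P (F x))%E.
Proof.
move=> mF; elim: s => [|x s [ms IH]].
  rewrite big_nil (_ : [set _ | _]%classic = classical_sets.set0) ?measure0 //.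
  by apply/seteqP; split => // o [].
rewrite (_ : [set _ | _]%classic = (F x `|` [set o | exists2 x, x \in s & F x o])%classic).
  split; first exact: measurableU.
  rewrite big_cons; apply: le_trans (_ : P (F x) + P _ <= _)%E; last exact: leeD2l IH.
  exact: measureU2.
apply/seteqP; split => o /=.
  by case=> z; rewrite inE => /orP[/eqP ->|zs] Fz; [left|right; exists z].
by case=> [Fx|[z zs Fz]]; [exists x|exists z]; rewrite ?mem_head // inE zs orbT.
Qed.

(** Written as a finite union over the sets of [k] edges, which gives measurability and the union
    bound together. *)
Definition many_light (y : R) (k : nat) : set Omega :=
  [set o | exists2 J, J \in enum [set B : {set {set V}} | (B \subset edges e) && (#|B| == k)]%SET
    & all_light y J o]%classic.

Lemma measurable_many_light (y : R) (k : nat) : measurable (many_light y k).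
Proof. by have [] := probability_exists_le (enum [set B : {set {set V}} | (B \subset edges e) && (#|B| == k)]%SET) (measurable_all_light y). Qed.

Lemma many_light_le (y : R) (k : nat) : 0 <= y ->
  (P (many_light y k) <= ('C(#|edges e|, k)%:R * y ^+ k)%:E)%E.
Proof.
move=> y0; have [_ /le_trans] := probability_exists_le
  (enum [set B : {set {set V}} | (B \subset edges e) && (#|B| == k)]%SET) (measurable_all_light y).
apply; rewrite big_enum /=.
apply: (@le_trans _ _ (\sum_(B in [set B : {set {set V}} | (B \subset edges e) && (#|B| == k)]%SET)
   (y ^+ k)%:E)%E).
  apply: lee_sum => B; rewrite inE => /andP[BE /eqP <-]; exact: all_light_le.
by rewrite sumEFin sumr_const cards_draws mulr_natl.
Qed.

Lemma light_edges_many_light (y : R) (k : nat) (o : Omega) :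
  (k <= #|[set a in edges e | (w a o < y)%R]%SET|)%N -> many_light y k o.
Proof.
set L := finset.finset _ => kL.
exists [set a in take k (enum L)]%SET.
  rewrite mem_enum inE; apply/andP; split.
    apply/fintype.subsetP => a; rewrite inE => /mem_take.
    by rewrite mem_enum inE => /andP[].
  rewrite cardsE (card_uniqP _) ?take_uniq ?enum_uniq // size_take -cardE.
  by case: ltngtP kL => // ->.
by move=> a; rewrite inE => /mem_take; rewrite mem_enum inE => /andP[].
Qed.

End LightProbability.

(** * Expectation below a measurable majorant *)

Section Majorant.
Context {disp : measure_display} {Omega : measurableType disp} {R : realType}.
Variable P : probability Omega R.
Import HBNNSimple.

(* [f] need not be measurable: the integral of its positive part is a supremum
   over simple functions below it. *)
Lemma expectation_le_majorant (f : Omega -> R) (G : Omega -> \bar R) (N : set Omega) :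
  measurable_fun setT G -> (forall o, (0 <= G o)%E) ->
  measurable N -> P N = 0%E -> (forall o, ~ N o -> ((f o)%:E <= G o)%E) ->
  ('E_P[f] <= \int[P]_o G o)%E.
Proof.
move=> mG G0 mN PN fG; rewrite unlock integralE.
apply: (@le_trans _ _ (\int[P]_x ((EFin \o f)^\+ x))%E).
  rewrite -[leRHS]sube0; apply: leeB => //; apply: integral_ge0 => x _.
  exact: funeneg_ge0.
rewrite ge0_integralTE; last by move=> x; exact: funepos_ge0.
apply: ge_ereal_sup => _ [h /= hf <-].
(* Each simple function [h] below the positive part of [f] is below [G] off the null set [N]. *)
rewrite -integralT_nnsfun; apply: ae_ge0_le_integral => //.
- by move=> x _; rewrite lee_fin; exact: fun_ge0.
- by apply/measurable_EFinP.
- exists N; split => // o /= H; apply: contrapT => No; apply: H => _.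
  apply: (le_trans (hf o)); rewrite funeposE /= ge_max G0 andbT.
  exact: fG.
Qed.

End Majorant.

(** * Summation over the layers *)

Section Layers.
Context {R : realType} {V : finType} (e : rel V).
Hypotheses (e_sym : symmetric e) (e_irr : irreflexive e).
Hypotheses (e_conn : forall u v, connect e u v) (V_gt1 : (1 < #|V|)%N).
Context {disp : measure_display} {Omega : measurableType disp}.
Variables (P : probability Omega R) (w : {set V} -> {RV P >-> R}).
Hypothesis w_iid : iid_exponential (edges e) w.

Local Notation alpha := (@Defs.alpha R V e).
Local Notation beta := (@Defs.beta R V e).
Local Notation radius := (@scale_radius R V e).
Local Notation n := #|V|.

Let a_gt0 : 0 < alpha := alpha_gt0 V_gt1 e_conn.
Let n_gt0 : 0 < n%:R :> R. Proof. by rewrite ltr0n ltnW. Qed.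

Definition layer_term (j : nat) (o : Omega) : R :=
  4 * (radius j.+1 - radius j) *
    (n%:R / 2 ^+ j + #|small_ball_vertices e w j o|%:R).

Lemma scale_radius_diff j :
  radius j.+1 - radius j = 4 * (2 * j%:R + 1) / (alpha * n%:R).
Proof. by rewrite /scale_radius -[j.+1%:R]natr1 -mulrBl; congr (_ / _); ring. Qed.

Let diff_ge0 j : 0 <= 4 * (radius j.+1 - radius j).
Proof.
rewrite scale_radius_diff mulr_ge0 // divr_ge0 ?mulr_ge0 ?addr_ge0 ?mulr_ge0 //.
by rewrite ltW.
Qed.

Lemma layer_term_ge0 j o : 0 <= layer_term j o.
Proof.
by rewrite /layer_term mulr_ge0 ?diff_ge0 // addr_ge0 // divr_ge0 ?exprn_ge0.
Qed.

Let layer_termE j o : (layer_term j o)%:E =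
  ((4 * (radius j.+1 - radius j))%:E *
   ((n%:R / 2 ^+ j)%:E +
    \sum_(v : V) (\1_[set o | v \in small_ball_vertices e w j o] o)%:E))%E.
Proof.
rewrite sumEFin -EFinD -EFinM; congr EFin; rewrite /layer_term; congr (_ * (_ + _)).
rewrite -sum1_card natr_sum big_mkcond /=; apply: eq_bigr => v _.
by rewrite indicE; case: ifPn => h; [rewrite mem_set|rewrite memNset //=; exact/negP].
Qed.

Let m_ind j v : measurable_fun setT
  (fun o => (\1_[set o | v \in small_ball_vertices e w j o]%classic o : R)%:E).
Proof.
apply/measurable_EFinP; apply: measurable_indic.
exact: measurable_small_ball.
Qed.

Let m_sum j : measurable_fun setT
  (fun o => (\sum_(v : V) (\1_[set o | v \in small_ball_vertices e w j o]%classic o : R)%:E)%E).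
Proof. by apply: emeasurable_sum => v; exact: m_ind. Qed.

Lemma measurable_layer_term j : measurable_fun setT (fun o => (layer_term j o)%:E).
Proof.
have m := emeasurable_funD (@measurable_cst _ _ _ _ setT (n%:R / 2 ^+ j)%:E) (m_sum j).
have := measurable_funeM (4 * (radius j.+1 - radius j))%:E m.
by congr measurable_fun; apply/funext => o; rewrite layer_termE.
Qed.

(** The radius grows by [4 * (2 * j + 1) / (alpha * n)], and the second factor has mean at most
    [2 * n / 2 ^ j]: one half is the deterministic count, the other the expected number of vertices
    with a small ball. *)
Lemma integral_layer_term_le j :
  (\int[P]_o (layer_term j o)%:E <= (32 / alpha * ((2 * j%:R + 1) / 2 ^+ j))%:E)%E.
Proof.
under eq_integral do rewrite layer_termE.
rewrite ge0_integralZl //; last 3 first.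
- exact: emeasurable_funD (@measurable_cst _ _ _ _ setT (n%:R / 2 ^+ j)%:E) (m_sum j).
- by move=> o _; rewrite adde_ge0 ?sume_ge0 // ?lee_fin ?divr_ge0 ?exprn_ge0 // => v _; rewrite lee_fin.
- by rewrite lee_fin diff_ge0.
have i1 (o : Omega) : setT o -> (0 <= (cst (n%:R / 2 ^+ j)%:E : Omega -> \bar R) o)%E.
  by rewrite lee_fin divr_ge0 ?exprn_ge0.
have i2 (o : Omega) : setT o ->
    (0 <= \sum_(v : V) (\1_[set o | v \in small_ball_vertices e w j o] o : R)%:E)%E.
  by move=> _; apply: sume_ge0 => v _; rewrite lee_fin.
rewrite (ge0_integralD P measurableT i1 (measurable_cst _) i2 (m_sum j)).
have -> : (\int[P]_o (cst (n%:R / 2 ^+ j)%:E : Omega -> \bar R) o = (n%:R / 2 ^+ j)%:E)%E.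
  rewrite integral_cst //.
  exact: etrans (congr1 (fun z => (n%:R / 2 ^+ j)%:E * z)%E (probability_setT P)) (mule1 _).
rewrite ge0_integral_sum //.
apply: (@le_trans _ _ ((4 * (radius j.+1 - radius j))%:E *
    ((n%:R / 2 ^+ j)%:E + \sum_(v : V) (2 ^- j)%:E))%E).
  apply: lee_wpmul2l; first by rewrite lee_fin diff_ge0.
  rewrite leeD2lE //; apply: lee_sum => v _.
  rewrite integral_indic ?setIT //; last exact: measurable_small_ball.
  exact: small_ball_probability.
rewrite sumEFin sumr_const -[_ *+ #|_|]mulr_natr -EFinD -EFinM lee_fin.
rewrite scale_radius_diff le_eqVlt; apply/orP; left; apply/eqP.
have h1 : 2 ^+ j != 0 :> R by rewrite expf_neq0.
have h2 := lt0r_neq0 a_gt0; have h3 := lt0r_neq0 n_gt0.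
by field; rewrite ?h1 ?h2 ?h3.
Qed.

(** The number of layers needed depends on the outcome; the full series dominates all the partial
    sums. *)
Definition layer_series (o : Omega) : \bar R := (\sum_(j <oo) (layer_term j o)%:E)%E.

Lemma layer_series_ge0 o : (0 <= layer_series o)%E.
Proof. by apply: nneseries_ge0 => j _ _; rewrite lee_fin layer_term_ge0. Qed.

Lemma measurable_layer_series : measurable_fun setT layer_series.
Proof.
apply: ge0_emeasurable_sum => [j o _ _|j _]; first by rewrite lee_fin layer_term_ge0.
exact: measurable_layer_term.
Qed.

Let sum_odd_div_pow2 (m : nat) :
  \sum_(0 <= j < m) ((2 * j%:R + 1) / 2 ^+ j) = 6 - (4 * m%:R + 6) / 2 ^+ m :> R.
Proof.
elim: m => [|m IH]; first by rewrite big_nil expr0; field.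
rewrite big_nat_recr //= IH exprS -[m.+1%:R]natr1.
have h1 : 2 ^+ m != 0 :> R by rewrite expf_neq0.
by field; rewrite ?h1.
Qed.

(** The series of [(2 * j + 1) / 2 ^ j] has sum 6, and [192 = 32 * 6]. *)
Lemma integral_layer_series_le : (\int[P]_o layer_series o <= (192 / alpha)%:E)%E.
Proof.
rewrite integral_nneseries //; last 2 first.
- exact: measurable_layer_term.
- by move=> j o _; rewrite lee_fin layer_term_ge0.
apply: lime_le.
  apply: is_cvg_nneseries => j _ _; apply: integral_ge0 => o _.
  by rewrite lee_fin layer_term_ge0.
apply: nearW => m.
apply: (@le_trans _ _ (\sum_(0 <= j < m) (32 / alpha * ((2 * j%:R + 1) / 2 ^+ j))%:E)%E).
  by apply: lee_sum => j _; exact: integral_layer_term_le.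
rewrite sumEFin lee_fin -mulr_sumr sum_odd_div_pow2.
have h : 0 <= (4 * m%:R + 6) / 2 ^+ m :> R.
  by rewrite divr_ge0 ?exprn_ge0 ?addr_ge0 ?mulr_ge0.
have a0 : 0 <= alpha^-1 by rewrite invr_ge0 ltW.
by nra.
Qed.

Lemma insertion_le_layer_series (o : Omega) (rho : insertion_rule R V) t :
  (forall a, a \in edges e -> 0 <= w a o) ->
  insertion_output rho (sp_dist e (fun a => w a o)) t ->
  ((tour_length (sp_dist e (fun a => w a o)) t)%:E <= layer_series o)%E.
Proof.
move=> w0; set D := sp_dist e _ => out.
have D_ge0 u v : 0 <= D u v by exact: sp_dist_ge0.
have D_xx u : D u u = 0 by exact: sp_distxx.
have D_sym u v : D u v = D v u by exact: sp_dist_sym.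
have D_tri u v x : D u x <= D u v + D v x by exact: sp_dist_triangle.
have gb := insertion_output_greedy D_ge0 D_xx D_sym D_tri out.
have [m le_m] : exists m, tour_length D t <= \sum_(j < m)
    4 * (radius j.+1 - radius j) *
    (n%:R / 2 ^+ j + #|small_ball_vertices e w j o|%:R).
  apply: (@greedy_bound_layers _ _ _ D_sym D_tri D_xx (ltnW V_gt1) radius
    (fun j => small_ball_vertices e w j o)) gb.
  - by rewrite /scale_radius expr0n mulr0 mul0r.
  - by move=> j; have := diff_ge0 j; lra.
  - move=> y; have c0 : 0 < 4 / (alpha * n%:R) by rewrite divr_gt0 // mulr_gt0.
    (* This [m] exceeds [y * alpha * n / 4] and is at least 1, so [m <= m ^ 2] gives
       [y <= radius m]. *)
    exists (Num.truncn (y / (4 / (alpha * n%:R)))).+1; set m := (_.+1).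
    have : y / (4 / (alpha * n%:R)) < m%:R by exact: truncnS_gt.
    rewrite ltr_pdivrMr // => /ltW/le_trans; apply.
    rewrite /scale_radius mulrAC [leRHS]mulrC ler_wpM2r ?(ltW c0) //.
    by rewrite expr2 ler_peMr // ler1n.
  - move=> j v; rewrite inE -leqNgt => /leq_trans; apply; apply: subset_leq_card.
    apply/fintype.subsetP => u ub; rewrite inE -scale_radiusE //.
    by apply: (level_ball_dist (mesh_ge0 e_conn V_gt1 j) w0 (leqnn _)) ub.
apply: (@le_trans _ _ (\sum_(0 <= j < m) (layer_term j o)%:E)%E).
  by rewrite sumEFin lee_fin big_mkord.
by apply: nneseries_lim_ge => j _ _; rewrite lee_fin layer_term_ge0.
Qed.

End Layers.

(** * Short tours and the approximation ratio *)

Section ShortTours.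
Context {R : realType} {V : finType} (e : rel V).
Hypotheses (e_sym : symmetric e) (e_irr : irreflexive e).
Hypotheses (e_conn : forall u v, connect e u v) (V_gt1 : (1 < #|V|)%N).
Context {disp : measure_display} {Omega : measurableType disp}.
Variables (P : probability Omega R) (w : {set V} -> {RV P >-> R}).
Hypothesis w_iid : iid_exponential (edges e) w.

Local Notation alpha := (@Defs.alpha R V e).
Local Notation beta := (@Defs.beta R V e).
Local Notation n := #|V|.

Let a_gt0 : 0 < alpha := alpha_gt0 V_gt1 e_conn.
Let b_gt0 : 0 < beta := lt_le_trans a_gt0 (alpha_le_beta e V_gt1).
Let n_gt0 : 0 < n%:R :> R. Proof. by rewrite ltr0n ltnW. Qed.

(** The exceptional null set: exponential weights are nonnegative only almost surely, and the
    distance estimates are applied outside it. *)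
Definition negative_weight : set Omega :=
  [set o | exists2 a, a \in enum (edges e) & w a o < 0]%classic.

Let measurable_lt0 a : measurable [set o | w a o < 0]%classic.
Proof.
apply: (@measurable_weight _ _ _ _ P w a [set s | s < 0]%classic).
rewrite (_ : [set s | _]%classic = `]-oo, 0[%classic); first exact: measurable_itv.
by apply/seteqP; split => s /=; rewrite in_itv.
Qed.

Lemma measurable_negative_weight : measurable negative_weight.
Proof. by have [] := probability_exists_le P (enum (edges e)) measurable_lt0. Qed.

Lemma negative_weight0 : P negative_weight = 0%E.
Proof.
apply/eqP; rewrite eq_le measure_ge0 andbT.
have [_ /le_trans] := probability_exists_le P (enum (edges e)) measurable_lt0; apply.
rewrite big_enum /= big1 // => a aE.
have := exponential_lt0 (fun B => w_iid.2 a aE B); move=> <-.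
by congr (P _); apply/seteqP; split => o /=; rewrite in_itv.
Qed.

Lemma nonnegative_weights o : ~ negative_weight o ->
  forall a, a \in edges e -> 0 <= w a o.
Proof.
by move=> H a aE; rewrite leNgt; apply/negP => lt; apply: H; exists a; rewrite ?mem_enum.
Qed.

(* Each of the [#|V| %/ 4 + 1] light edges costs a factor [32 / 512 = 1 / 16]. *)
Definition short_tour_bound : R := 512^-1 / beta.
(** The threshold and the count are those of [tsp_lt_light_edges], so that outside [negative_weight]
    this event contains all outcomes whose shortest tour is below [short_tour_bound]. *)
Definition short_tour_event : set Omega :=
  many_light e w (2 * short_tour_bound / n%:R) (n %/ 4).+1.

Let bound_gt0 : 0 < short_tour_bound.
Proof. by apply: divr_gt0 b_gt0; rewrite invr_gt0 ltr0n. Qed.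

Lemma short_tour_event_le : (P short_tour_event <= (n%:R^-1)%:E)%E.
Proof.
set y := 2 * short_tour_bound / n%:R; set k := (n %/ 4).+1.
have y0 : 0 <= y by apply: divr_ge0 => //; apply: mulr_ge0 => //; exact: ltW.
apply: (le_trans (many_light_le w_iid k y0)); rewrite lee_fin.
apply: (le_trans (binomial_power_le #|edges e| y0 (ltn0Sn _))).
have nk : (n <= 4 * k)%N by rewrite /k mulnC; apply: ltnW; exact: ltn_ceil.
have k0 : 0 < k%:R :> R by rewrite ltr0n.
(* With at most [beta * n ^ 2] edges, [4 * (beta * n ^ 2) * y = n / 64], which is at most [k / 16]
   because [n <= 4 * k]. *)
have base : 4 * #|edges e|%:R * y / k%:R <= 2 ^- 4.
  rewrite ler_pdivrMr //.
  apply: (@le_trans _ _ (4 * (beta * n%:R ^+ 2) * y)).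
    by rewrite ler_wpM2r // ler_wpM2l // card_edges_le.
  have -> : 4 * (beta * n%:R ^+ 2) * y = 2 ^- 6 * n%:R.
    rewrite /y /short_tour_bound; field.
    by rewrite ?(lt0r_neq0 b_gt0) ?(lt0r_neq0 n_gt0).
  have : n%:R <= 4 * k%:R :> R by rewrite -natrM ler_nat.
  lra.
apply: (@le_trans _ _ ((2 ^- 4) ^+ k)).
  have p0 : 0 <= 4 * #|edges e|%:R * y / k%:R by apply: divr_ge0 => //; apply: mulr_ge0 y0; apply: mulr_ge0.
  by rewrite lerXn2r // nnegrE // invr_ge0 exprn_ge0.
(* [16 ^ k = 2 ^ (4 * k)] is at least [2 ^ n], hence at least [n]. *)
rewrite exprVn -exprM lef_pV2 ?posrE ?exprn_gt0 //.
rewrite -natrX ler_nat; apply: leq_trans (ltnW (ltn_expl n (ltnSn 1))) _.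
by rewrite leq_exp2l.
Qed.

Lemma ratio_majorant (o : Omega) (rho : insertion_rule R V) t :
  let D := sp_dist e (fun a => w a o) in
  ~ negative_weight o -> insertion_output rho D t ->
  ((tour_length D t / tsp D)%:E <=
   (512 * beta)%:E * layer_series e w o + (2 * n%:R)%:E * (\1_short_tour_event o)%:E)%E.
Proof.
move=> D /nonnegative_weights w0 out.
have D_ge0 u v : 0 <= D u v by exact: sp_dist_ge0.
have D_xx u : D u u = 0 by exact: sp_distxx.
have D_sym u v : D u v = D v u by exact: sp_dist_sym.
have D_tri u v x : D u x <= D u v + D v x by exact: sp_dist_triangle.
have IN0 : 0 <= tour_length D t by exact: tour_length_ge0.
have c0 : (0 <= (512 * beta)%:E)%E.
  rewrite lee_fin; exact: mulr_ge0 (ler0n _ _) (ltW b_gt0).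
have series0 := layer_series_ge0 e_conn V_gt1 w o.
have [long|short] := leP short_tour_bound (tsp D).
  apply: (@le_trans _ _ ((512 * beta)%:E * layer_series e w o)%E); last first.
    by apply: leeDl; rewrite mule_ge0 // lee_fin // mulr_ge0.
  apply: (@le_trans _ _ ((512 * beta)%:E * (tour_length D t)%:E)%E); last first.
    by apply: (lee_wpmul2l c0); exact: insertion_le_layer_series out.
  rewrite -EFinM lee_fin mulrC ler_wpM2r //.
  have -> : 512 * beta = short_tour_bound^-1 by rewrite /short_tour_bound invf_div invrK mulrC.
  by rewrite lef_pV2 // posrE (lt_le_trans bound_gt0).
have ev : short_tour_event o.
  apply: light_edges_many_light.
  exact: (tsp_lt_light_edges e_conn V_gt1 w0 bound_gt0 short).
apply: (@le_trans _ _ ((2 * n%:R)%:E * (\1_short_tour_event o)%:E)%E); last first.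
  exact: leeDr (mule_ge0 c0 series0).
rewrite indicE mem_set // (_ : true%:R = 1) // mule1 lee_fin.
have := insertion_output_le_tsp D_ge0 D_xx D_sym D_tri out (ltnW V_gt1).
have [tsp0|tsp0] := ltP 0 (tsp D); first by rewrite ler_pdivrMr.
(* If [tsp D <= 0], the bound [h] forces the tour length to be 0, and with it the quotient. *)
move=> h; have -> : tour_length D t = 0.
  apply/eqP; rewrite eq_le IN0 andbT (le_trans h) //.
  by rewrite mulr_ge0_le0 // mulr_ge0.
by rewrite mul0r mulr_ge0.
Qed.

Lemma measurable_short_tour_event : measurable short_tour_event.
Proof. exact: measurable_many_light. Qed.

(** The short tours contribute at most [2 * n / n = 2], which is absorbed because
    [1 <= beta / alpha]. *)
Lemma integral_ratio_majorant_le :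
  (\int[P]_o ((512 * beta)%:E * layer_series e w o +
     (2 * n%:R)%:E * (\1_short_tour_event o)%:E) <= ((512 * 192 + 2) * (beta / alpha))%:E)%E.
Proof.
have c0 : (0 <= (512 * beta)%:E)%E.
  rewrite lee_fin; exact: mulr_ge0 (ler0n _ _) (ltW b_gt0).
have mL := measurable_layer_series e_conn V_gt1 w.
have L0 := layer_series_ge0 e_conn V_gt1 w.
have mI : measurable_fun setT (fun o => (\1_short_tour_event o : R)%:E).
  by apply/measurable_EFinP; apply: measurable_indic; exact: measurable_short_tour_event.
have i1 (o : Omega) : setT o -> (0 <= (512 * beta)%:E * layer_series e w o)%E.
  by move=> _; exact: mule_ge0 c0 (L0 o).
have i2 (o : Omega) : setT o -> (0 <= (2 * n%:R)%:E * (\1_short_tour_event o : R)%:E)%E.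
  by move=> _; rewrite mule_ge0 // lee_fin // mulr_ge0.
rewrite (ge0_integralD P measurableT i1 (measurable_funeM _ mL) i2 (measurable_funeM _ mI)).
rewrite (ge0_integralZl P measurableT mL) //.
rewrite (ge0_integralZl P measurableT mI) //.
rewrite integral_indic ?setIT //; last exact: measurable_short_tour_event.
apply: (@le_trans _ _ ((512 * beta)%:E * (192 / alpha)%:E + (2 * n%:R)%:E * (n%:R^-1)%:E)%E).
  apply: leeD.
    by apply: (lee_wpmul2l c0); exact: integral_layer_series_le.
  apply: lee_wpmul2l; first by rewrite lee_fin mulr_ge0.
  exact: short_tour_event_le.
rewrite -!EFinM -EFinD lee_fin mulfK ?lt0r_neq0 //.
have ratio1 : 1 <= beta / alpha by rewrite ler_pdivlMr // mul1r alpha_le_beta.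
have -> : 512 * beta * (192 / alpha) = 512 * 192 * (beta / alpha) by rewrite mulrACA.
lra.
Qed.

End ShortTours.

Unset Implicit Arguments.

Theorem theorem5 (R : realType) :
  exists C : R, 0 < C /\
  forall (V : finType) (e : rel V),
    symmetric e -> irreflexive e -> (forall u v : V, connect e u v) ->
    (1 < #|V|)%N ->
  forall (disp : measure_display) (Omega : measurableType disp)
    (P : probability Omega R) (w : {set V} -> {RV P >-> R}),
    iid_exponential (edges e) w ->
  let D (omega : Omega) : V -> V -> R := sp_dist e (fun a => w a omega) in
  forall (rule : Omega -> insertion_rule R V) (tour : Omega -> seq V),
    (forall omega, insertion_output (rule omega) (D omega) (tour omega)) ->
  let IN (omega : Omega) : R := tour_length (D omega) (tour omega) in
  let TSP (omega : Omega) : R := tsp (D omega) in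
    measurable_fun [set: Omega]%classic IN ->
    ('E_P[IN] <= (C / alpha e)%:E)%E /\
    ('E_P[(fun omega => (IN omega / TSP omega)%R)] <= (C * (beta e / alpha e))%:E)%E.
Proof.
(* The value required by the ratio; the length alone would only need 192. *)
exists (512 * 192 + 2); split; first by lra.
move=> V e e_sym e_irr e_conn V_gt1 disp Omega P w w_iid D rule tour out IN TSP _.
have mN := measurable_negative_weight e w; have N0 := negative_weight0 w_iid.
have mL := measurable_layer_series e_conn V_gt1 w.
have L0 := layer_series_ge0 e_conn V_gt1 w.
have a_gt0 : 0 < alpha e :> R := alpha_gt0 V_gt1 e_conn.
split.
  apply: (@le_trans _ _ (\int[P]_o layer_series e w o)%E).
    apply: expectation_le_majorant mL L0 mN N0 _ => o /nonnegative_weights w0.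
    exact: insertion_le_layer_series (out o).
  apply: le_trans (integral_layer_series_le e_sym e_irr e_conn V_gt1 w_iid) _.
  by rewrite lee_fin ler_wpM2r ?invr_ge0 ?(ltW a_gt0) //; lra.
apply: le_trans (integral_ratio_majorant_le e_sym e_irr e_conn V_gt1 w_iid).
have b_ge0 : 0 <= beta e :> R by apply: le_trans (ltW a_gt0) (alpha_le_beta e V_gt1).
apply: expectation_le_majorant mN N0 _.
- apply: emeasurable_funD; apply: measurable_funeM => //.
  apply/measurable_EFinP; apply: measurable_indic; exact: measurable_short_tour_event.
- move=> o; apply: adde_ge0.
    by apply: mule_ge0 (L0 o); rewrite lee_fin; exact: mulr_ge0 (ler0n _ _) b_ge0.
  by apply: mule_ge0; rewrite lee_fin ?mulr_ge0.
- by move=> o No; exact: ratio_majorant (out o).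
Qed.
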